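(* The map $\zeta^T_{\mathrm{st}}:\mathcal{F}^{\mathrm{conv}}_{\mathbb{N}^*}\to\mathbb{R}$ (resp. $\zeta^{T,\star}_{\mathrm{st}}:\mathcal{F}^{\mathrm{conv}}_{\mathbb{N}^*}\to\mathbb{R}$, resp. $\zeta^T_{\mathrm{sh}}:\mathcal{F}^{\mathrm{conv}}_{\{x,y\}}\to\mathbb{R}$) is an algebra morphism for the stuffle product on trees $\sqcup\!\sqcup_1$ (resp. the anti-stuffle product on trees $\sqcup\!\sqcup_{-1}$, resp. the shuffle product on trees $\sqcup\!\sqcup_0$), where $\mathbb{R}$ carries its usual product.
   Context: $\mathbb{N}^*=\mathbb{Z}_{\ge1}$. A rooted forest is a finite (possibly empty) disjoint union of finite (non-planar) rooted trees; an $\Omega$-decorated forest carries a map from its vertex set to $\Omega$; forests are taken up to isomorphism. $\mathcal{F}_\Omega$ is the commutative unital $\mathbb{R}$-algebra freely generated by nonempty $\Omega$-decorated rooted trees: product is concatenation (disjoint union), unit is the empty forest $\emptyset$, forests form a basis. $|F|$ is the number of vertices of $F$. $B_+^\omega(F)$ is the tree obtained from $F$ by adding a new root decorated by $\omega$ joined to every root of $F$ (extended linearly in $F$). A leaf is a vertex without direct successor (child); a branching vertex has strictly more than one direct successor. $\lambda$-shuffle of trees. Let $(\Omega,\cdot)$ be a commutative semigroup and $\lambda\in\mathbb{R}$ (for $\lambda=0$, $\Omega$ may be any set). The bilinear product $\sqcup\!\sqcup_\lambda$ on $\mathcal{F}_\Omega$ is defined on forests by recursion on $|F|+|F'|$: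 (i) $\emptyset\sqcup\!\sqcup_\lambda F=F\sqcup\!\sqcup_\lambda\emptyset=F$; (ii) if $F=T_1\cdots T_k$, $F'=t_1\cdots t_n$ with all $T_i,t_j$ nonempty trees, $k,n\ge1$, $k+n\ge3$: $F\sqcup\!\sqcup_\lambda F'=\frac1{kn}\sum_{i=1}^k\sum_{j=1}^n(T_i\sqcup\!\sqcup_\lambda t_j)\,T_1\cdots\widehat{T_i}\cdots T_k\,t_1\cdots\widehat{t_j}\cdots t_n$ (hats denote omission); (iii) if $T=B_+^a(f)$, $T'=B_+^{a'}(f')$: $T\sqcup\!\sqcup_\lambda T'=B_+^a(f\sqcup\!\sqcup_\lambda T')+B_+^{a'}(T\sqcup\!\sqcup_\lambda f')+\lambda B_+^{a\cdot a'}(f\sqcup\!\sqcup_\lambda f')$. For $\Omega=\mathbb{N}^*$ the semigroup law is addition. The (not necessarily associative) products preserve the spaces of convergent forests below. Series values. An $\mathbb{N}^*$-decorated forest is convergent if it is empty or all its roots have decoration $\ge2$; $\mathcal{F}^{\mathrm{conv}}_{\mathbb{N}^*}$ is their linear span. For $\lambda\in\{-1,0\}$ define $\mathcal{Z}_\lambda(F):\mathbb{N}^*\to\mathbb{R}$ by $\mathcal{Z}_\lambda(\emptyset)=1$, $\mathcal{Z}_\lambda(F_1F_2)=\mathcal{Z}_\lambda(F_1)\mathcal{Z}_\lambda(F_2)$, $\mathcal{Z}_\lambda(B_+^\alpha(F))(N)=\sum_{n=1}^{N+\lambda}n^{-\alpha}\mathcal{Z}_\lambda(F)(n)$ (empty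 sum $=0$). For convergent $F$, $\zeta^T_{\mathrm{st}}(F)=\lim_{N\to\infty}\mathcal{Z}_{-1}(F)(N)$ and $\zeta^{T,\star}_{\mathrm{st}}(F)=\lim_{N\to\infty}\mathcal{Z}_0(F)(N)$ (the limits exist), extended linearly. Integral values. A forest in $\mathcal{F}_{\{x,y\}}$ is convergent if all its leaves and branching vertices are decorated by $y$ and all its roots by $x$ (the empty forest is convergent); $\mathcal{F}^{\mathrm{conv}}_{\{x,y\}}$ is their linear span. With $\sigma_x(t)=1/t$, $\sigma_y(t)=1/(1-t)$ and $0<\epsilon<1$ define on $[\epsilon,1[$: $A_\epsilon(\emptyset)=1$, $A_\epsilon(F_1F_2)=A_\epsilon(F_1)A_\epsilon(F_2)$, $A_\epsilon(B_+^\omega(F))(z)=\int_\epsilon^z\sigma_\omega(t)A_\epsilon(F)(t)dt$. For convergent $F$, $\zeta^T_{\mathrm{sh}}(F)=\lim_{z\to1^-}\lim_{\epsilon\to0^+}A_\epsilon(F)(z)$ (the limits exist), extended linearly. *)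

(* Defs.v *)
From Stdlib Require List.
From HB Require Import structures.
From mathcomp Require Import all_boot all_order all_algebra finmap.
From mathcomp Require Import monalg zify.
From mathcomp Require Import all_classical all_reals all_analysis.

Set Implicit Arguments.
Unset Strict Implicit.
Unset Printing Implicit Defensive.

Import Order.TTheory GRing.Theory Num.Theory.
Import numFieldNormedType.Exports.

Local Open Scope ring_scope.

Section PlanarTrees.
Variable W : Type.

Inductive ptree := PNode of W & seq ptree.

Definition proot (t : ptree) := let: PNode a _ := t in a.
Definition psons (t : ptree) := let: PNode _ s := t in s.

Fixpoint ptree_ind' (P : ptree -> Prop)
    (IH : forall a s, List.Forall P s -> P (PNode a s)) t : P t :=
  let: PNode a s := t in
  IH a s ((fix F s : List.Forall P s :=
    if s is u :: s' then List.Forall_cons _ (ptree_ind' IH u) (F s')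
    else List.Forall_nil P) s).

Fixpoint pencode (t : ptree) : GenTree.tree W :=
  let: PNode a s := t in GenTree.Node 0 (GenTree.Leaf a :: map pencode s).

Fixpoint pdecode (g : GenTree.tree W) : option ptree :=
  if g is GenTree.Node _ (GenTree.Leaf a :: s) then
    Some (PNode a (pmap pdecode s)) else None.

Lemma pencodeK : pcancel pencode pdecode.
Proof.
elim/ptree_ind' => a s IH /=; congr (Some (PNode a _)).
by elim: IH => //= u s' -> _ ->.
Qed.

Fixpoint nvert (t : ptree) : nat :=
  let: PNode _ s := t in (sumn (map nvert s)).+1.

Section Fold.
Variables (A : comPzRingType) (phi : W -> A -> A).

Fixpoint ptree_fold (t : ptree) : A :=
  let: PNode a s := t in
  phi a (foldr (fun u p => ptree_fold u * p) 1 s).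

End Fold.
End PlanarTrees.

HB.instance Definition _ (W : choiceType) :=
  Choice.copy (ptree W) (pcan_type (@pencodeK W)).

Section Trees.
Variable W : choiceType.
Implicit Types (a b : W) (s : seq (ptree W)).

(* A representative of the class of [s] modulo permutation. *)
Definition canon s : seq (ptree W) := choose (perm_eq s) s.

Lemma perm_canon s : perm_eq s (canon s).
Proof. exact: chooseP. Qed.

Lemma eq_canon s1 s2 : perm_eq s1 s2 -> canon s1 = canon s2.
Proof.
move=> p; rewrite /canon (@eq_choose _ _ (perm_eq s2)); last first.
  by move=> s; apply: (permPl p).
by apply: choose_id => //; rewrite perm_sym.
Qed.

(* Two planar trees are isomorphic as rooted decorated trees if and only if  *)
(* they have the same normal form, cf. [eq_norm].                            *)
Fixpoint norm (t : ptree W) : ptree W :=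
  let: PNode a s := t in PNode a (canon (map norm s)).

Lemma eq_norm a b s1 s2 :
  norm (PNode a s1) = norm (PNode b s2) <->
  a = b /\ perm_eq (map norm s1) (map norm s2).
Proof.
split=> /= [[-> e]|[-> /eq_canon -> //]]; split=> //.
by apply: perm_trans (perm_canon _) _; rewrite e perm_sym perm_canon.
Qed.

Lemma norm_idem t : norm (norm t) = norm t.
Proof.
elim/ptree_ind': t => a s IH /=; congr PNode.
have e : map norm (map norm s) = map norm s by elim: IH => //= u s' -> _ ->.
by rewrite -[in RHS]e; apply: eq_canon; rewrite perm_sym; apply/perm_map/perm_canon.
Qed.

(* Non-planar trees, i.e. isomorphism classes of planar ones, each being     *)
(* represented by its normal form.                                           *)
Definition tree := {t : ptree W | norm t == t}.

Definition tclass (t : ptree W) : tree :=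
  exist _ (norm t) (introT eqP (norm_idem t)).

Lemma tclassK (T : tree) : tclass (val T) = T.
Proof. by apply: val_inj => /=; apply/eqP; exact: valP T. Qed.

Lemma eq_tclass t u : tclass t = tclass u <-> norm t = norm u.
Proof. by split=> [[]//|e]; apply: val_inj. Qed.

(* A forest is a finite multiset of trees, written multiplicatively: [mone]  *)
(* is the empty forest, [mmul] the disjoint union and [ucm T] the tree [T].  *)
Definition forest := {cmonom tree}.

(* The trees of a forest, listed with multiplicity. *)
Definition trees (F : forest) : seq tree :=
  flatten [seq nseq (F T) T | T <- finsupp F].

Definition forest_of (s : seq tree) : forest := \big[mmul/mone]_(T <- s) ucm T.

Definition fsize (F : forest) : nat :=
  (\sum_(T <- trees F) nvert (val T))%N.

Definition troot (T : tree) : W := proot (val T).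

Definition tsons (T : tree) : forest := forest_of (map tclass (psons (val T))).

Definition Bplus a (F : forest) : tree := tclass (PNode a (map val (trees F))).

(* Universal property of [Bplus]: the multiplicative map [Phi] such that     *)
(* [Phi (ucm (Bplus a F)) = phi a (Phi F)], cf. [forest_fold1],              *)
(* [forest_foldM] and [forest_foldB].                                        *)
Definition forest_fold (A : comPzRingType) (phi : W -> A -> A) (F : forest) : A :=
  \prod_(T <- trees F) ptree_fold phi (val T).

Lemma count_trees (F : forest) T : count_mem T (trees F) = F T.
Proof.
rewrite /trees count_flatten -map_comp sumnE big_map.
under eq_bigr => U _ do rewrite /= count_nseq /=.
have [nFi|Fi] := finsuppP F T.
  rewrite big_seq big1 // => U FU; case: (boolP (U == T)) => //= e.
  by move: FU nFi; rewrite (eqP e) => ->.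
rewrite (big_fsetD1 T) //= eqxx mul1n big1_seq ?addn0 // => U /andP[_].
by rewrite in_fsetE in_fset1 => /andP[/negPf-> _].
Qed.

Lemma forest_ofE (s : seq tree) T : forest_of s T = count_mem T s.
Proof.
elim: s => [|u s IH]; rewrite /forest_of; first by rewrite big_nil cm1.
by rewrite big_cons cmM -/(forest_of s) IH cmU.
Qed.

Lemma treesK : cancel trees forest_of.
Proof. by move=> F; apply/eqP/cmP => T; rewrite forest_ofE count_trees. Qed.

Lemma perm_treesP (F : forest) (s : seq tree) :
  (forall T, F T = count_mem T s) <-> perm_eq (trees F) s.
Proof.
split=> [e|/permP e T]; last by rewrite -count_trees e.
by apply/allP => T _ /=; rewrite count_trees e.
Qed.

Lemma perm_trees_of (s : seq tree) : perm_eq (trees (forest_of s)) s.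
Proof. by apply/perm_treesP => T; rewrite forest_ofE. Qed.

Lemma trees1 : trees mone = [::].
Proof. by apply/perm_nilP/perm_treesP => T; rewrite cm1. Qed.

Lemma treesU T : trees (ucm T) = [:: T].
Proof.
by apply: perm_small_eq => //; apply/perm_treesP => U; rewrite cmU /= addn0.
Qed.

Lemma perm_treesM F G : perm_eq (trees (mmul F G)) (trees F ++ trees G).
Proof. by apply/perm_treesP => T; rewrite cmM count_cat !count_trees. Qed.

Lemma trees_eq0 F : (trees F == [::]) = (F == mone).
Proof.
by apply/eqP/eqP => [e|->]; rewrite ?trees1 // -(treesK F) e /forest_of big_nil.
Qed.

Lemma troot_Bplus a F : troot (Bplus a F) = a. Proof. by []. Qed.

Lemma norm_val (s : seq tree) : map (@norm) (map val s) = map val s.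
Proof.
by rewrite -map_comp; apply: eq_map => T /=; apply/eqP; exact: valP T.
Qed.

Lemma psons_normal a s :
  norm (PNode a s) = PNode a s -> {in s, forall u, norm u = u}.
Proof.
move=> [e] u; have := perm_canon (map norm s); rewrite e => /perm_mem <-.
by case/mapP => v _ ->; rewrite norm_idem.
Qed.

Lemma tsons_Bplus a F : tsons (Bplus a F) = F.
Proof.
rewrite -[RHS]treesK /tsons /Bplus /= norm_val.
apply/eqP/cmP => T; rewrite !forest_ofE; apply/permP.
rewrite perm_sym -[X in perm_eq X](map_id (trees F)) -(eq_map tclassK).
by rewrite (map_comp tclass val); apply/perm_map/perm_canon.
Qed.

Lemma BplusK T : Bplus (troot T) (tsons T) = T.
Proof.
apply: val_inj; case: T => -[a s] nT /=; rewrite /troot /tsons /=.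
have ns := psons_normal (eqP nT).
rewrite norm_val; have [{2}<-] := eqP nT; congr PNode; apply: eq_canon.
rewrite perm_sym; apply: perm_trans (perm_map val _); last first.
  by rewrite perm_sym; exact: perm_trees_of.
by rewrite -map_comp.
Qed.

Lemma fsizeM F G : fsize (mmul F G) = (fsize F + fsize G)%N.
Proof. by rewrite /fsize (perm_big _ (perm_treesM F G)) big_cat. Qed.

Lemma fsizeU T : fsize (ucm T) = (fsize (tsons T)).+1.
Proof.
rewrite /fsize treesU big_seq1 /tsons (perm_big _ (perm_trees_of _)) big_map.
case: T => -[a s] nT /=; have ns := psons_normal (eqP nT).
rewrite sumnE big_map; congr _.+1; apply: eq_big_seq => u us; by rewrite ns.
Qed.

Lemma fsizeU_le F T : T \in trees F -> (fsize (ucm T) <= fsize F)%N.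
Proof.
move=> TF; rewrite /fsize treesU big_seq1.
by rewrite (perm_big _ (perm_to_rem TF)) big_cons leq_addr.
Qed.

Lemma divUU T : divcm (ucm T) (ucm T) = mone :> forest.
Proof. by apply/eqP/cmP => U; rewrite divcmE cm1 subnn. Qed.

Section FoldTheory.
Variables (A : comPzRingType) (phi : W -> A -> A).

Lemma ptree_foldE a s :
  ptree_fold phi (PNode a s) = phi a (\prod_(u <- s) ptree_fold phi u).
Proof.
rewrite /=; congr (phi a _).
by elim: s => [|u s IH]; rewrite ?big_nil ?big_cons /= ?IH.
Qed.

Lemma ptree_fold_norm t : ptree_fold phi (norm t) = ptree_fold phi t.
Proof.
elim/ptree_ind': t => a s IH.
rewrite [norm _]/= !ptree_foldE; congr (phi a _).
rewrite -(perm_big _ (perm_canon _)) big_map.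
by elim: IH => [|u s' e _ IH]; rewrite ?big_nil // !big_cons e IH.
Qed.

Lemma forest_fold1 : forest_fold phi mone = 1.
Proof. by rewrite /forest_fold trees1 big_nil. Qed.

Lemma forest_foldM F G :
  forest_fold phi (mmul F G) = forest_fold phi F * forest_fold phi G.
Proof. by rewrite /forest_fold (perm_big _ (perm_treesM F G)) big_cat. Qed.

Lemma forest_foldB a F :
  forest_fold phi (ucm (Bplus a F)) = phi a (forest_fold phi F).
Proof.
by rewrite /forest_fold treesU big_seq1 ptree_fold_norm ptree_foldE big_map.
Qed.

End FoldTheory.
End Trees.

Section ForestAlgebra.
Variables (R : realType) (W : choiceType).

(* The free commutative algebra on [tree W]; the forests [<< F >>] form a    *)
(* basis and [*] is the concatenation of forests.                            *)
Definition forest_alg := {malg R[forest W]}.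

Definition linext (V : lmodType R) (phi : forest W -> V) (f : forest_alg) : V :=
  \sum_(F <- msupp f) f@_F *: phi F.

(* The linear span of the forests satisfying [P]. *)
Definition forest_span (P : pred (forest W)) : {pred forest_alg} :=
  fun f => all P (msupp f).

Definition BplusL (a : W) : forest_alg -> forest_alg :=
  linext (fun F => << ucm (Bplus a F) >> : forest_alg).

Variables (lam : R) (op : W -> W -> W).

(* If [lam = 0] the last term vanishes, so that [op] is irrelevant. *)
Definition tree_step (sh : forest W -> forest W -> forest_alg) (T t : tree W) :
    forest_alg :=
  BplusL (troot T) (sh (tsons T) (ucm t)) + BplusL (troot t) (sh (ucm T) (tsons t))
  + lam *: BplusL (op (troot T) (troot t)) (sh (tsons T) (tsons t)).

(* [n] bounds the total number of vertices.  The formula for two nonempty    *)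
(* forests with [k] and [l] trees also covers [k = l = 1].                   *)
Fixpoint shuffle_rec (n : nat) (F F' : forest W) : forest_alg :=
  if F == mone then << F' >> else if F' == mone then << F >> else
  if n is m.+1 then
    ((size (trees F) * size (trees F'))%N%:R)^-1 *:
    \sum_(T <- trees F) \sum_(t <- trees F')
      tree_step (shuffle_rec m) T t
      * << mmul (divcm F (ucm T)) (divcm F' (ucm t)) >>
  else 0.

(* The lambda-shuffle of two forests, characterised by [fshuffle1F],         *)
(* [fshuffleF1], [fshuffle_forests] and [fshuffle_trees].                    *)
Definition fshuffle (F F' : forest W) : forest_alg :=
  shuffle_rec (fsize F + fsize F') F F'.

Definition shuffle (f g : forest_alg) : forest_alg :=
  linext (fun F => linext (fshuffle F) g) f.

Lemma fshuffle1F F : fshuffle mone F = << F >>.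
Proof. by rewrite /fshuffle; case: (_ + _)%N => [|n] /=; rewrite eqxx. Qed.

Lemma fshuffleF1 F : fshuffle F mone = << F >>.
Proof.
by rewrite /fshuffle; case: (_ + _)%N => [|n] /=; rewrite eqxx; case: eqP => [->|].
Qed.

Lemma forest_gt0 (F : forest W) : F != mone -> (0 < fsize F)%N.
Proof.
rewrite -trees_eq0; case e: (trees F) => [//|T s] _.
by apply: leq_trans (@fsizeU_le _ _ T _); rewrite ?fsizeU // e mem_head.
Qed.

Lemma shuffle_recS n F F' : F != mone -> F' != mone ->
  shuffle_rec n.+1 F F' = ((size (trees F) * size (trees F'))%N%:R)^-1 *:
    \sum_(T <- trees F) \sum_(t <- trees F')
      tree_step (shuffle_rec n) T t
      * << mmul (divcm F (ucm T)) (divcm F' (ucm t)) >>.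
Proof.
by move=> F0 F'0; rewrite [LHS]/shuffle_rec -/shuffle_rec (negPf F0) (negPf F'0).
Qed.

Lemma tree_step_eq sh1 sh2 T t :
    (forall F F', (fsize F + fsize F' < fsize (ucm T) + fsize (ucm t))%N ->
       sh1 F F' = sh2 F F') ->
  tree_step sh1 T t = tree_step sh2 T t.
Proof.
have sT := fsizeU T; have st := fsizeU t; move=> e; rewrite /tree_step.
by rewrite (e (tsons T) (ucm t)) ?(e (ucm T) (tsons t))
  ?(e (tsons T) (tsons t)) //; lia.
Qed.

Lemma shuffle_rec_bound n m F F' :
    (fsize F + fsize F' <= n)%N -> (fsize F + fsize F' <= m)%N ->
  shuffle_rec n F F' = shuffle_rec m F F'.
Proof.
elim: n m F F' => [|n IH] m F F' le_n le_m.
  case: (eqVneq F mone) => [->|/forest_gt0 F0]; last by exfalso; lia.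
  by case: (m) => [|p] /=; rewrite eqxx.
case: (eqVneq F mone) => [->|F0].
  by case: (m) => [|p]; rewrite /shuffle_rec eqxx.
case: (eqVneq F' mone) => [->|F'0].
  by case: (m) => [|p]; rewrite /shuffle_rec (negPf F0) eqxx.
have F1 := forest_gt0 F0; case: m le_m => [|m] le_m; first by exfalso; lia.
rewrite (shuffle_recS n F0 F'0) (shuffle_recS m F0 F'0).
apply: (congr1 (GRing.scale _)).
apply: eq_big_seq => T TF; apply: eq_big_seq => t tF'.
apply: (congr1 ( *%R^~ _)); apply: tree_step_eq => G G' lt_G.
have le_T := fsizeU_le TF; have le_t := fsizeU_le tF'.
have le_G := leq_trans lt_G (leq_add le_T le_t).
by apply: IH; rewrite -ltnS (leq_trans le_G).
Qed.

Lemma shuffle_recE n F F' :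
  (fsize F + fsize F' <= n)%N -> shuffle_rec n F F' = fshuffle F F'.
Proof. by move=> le_n; exact: shuffle_rec_bound. Qed.

Lemma fshuffle_step T t : fshuffle (ucm T) (ucm t) = tree_step fshuffle T t.
Proof.
have h n F F' : F = ucm T -> F' = ucm t ->
    shuffle_rec n.+1 F F' = tree_step (shuffle_rec n) T t.
  move=> eF eF'.
  have F0 : F != mone by rewrite eF cm1_eq1.
  have F'0 : F' != mone by rewrite eF' cm1_eq1.
  have tF : trees F = [:: T] by rewrite eF treesU.
  have tF' : trees F' = [:: t] by rewrite eF' treesU.
  have dF : divcm F (ucm T) = mone by rewrite eF divUU.
  have dF' : divcm F' (ucm t) = mone by rewrite eF' divUU.
  rewrite (shuffle_recS n F0 F'0) tF tF' !big_seq1 mul1n invr1 scale1r dF dF'.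
  by rewrite mulm1 mulr1.
rewrite [LHS]/fshuffle; case e: (_ + _)%N => [|n].
  have : (fsize (ucm T) <= 0)%N by rewrite -e leq_addr.
  by rewrite fsizeU.
rewrite (h n _ _ erefl erefl); apply: tree_step_eq => G G' lt_G.
by apply: shuffle_recE; rewrite -ltnS -e.
Qed.

Lemma fshuffle_trees a a' f f' :
  let T := Bplus a f in let T' := Bplus a' f' in
  fshuffle (ucm T) (ucm T') =
    BplusL a (fshuffle f (ucm T')) + BplusL a' (fshuffle (ucm T) f')
    + lam *: BplusL (op a a') (fshuffle f f').
Proof.
move=> T T'.
have -> : f = tsons T by rewrite tsons_Bplus.
have -> : f' = tsons T' by rewrite tsons_Bplus.
have -> : a = troot T by []; have -> : a' = troot T' by [].
exact: fshuffle_step.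
Qed.

Lemma fshuffle_forests F F' : F != mone -> F' != mone ->
  fshuffle F F' = ((size (trees F) * size (trees F'))%N%:R)^-1 *:
    \sum_(T <- trees F) \sum_(t <- trees F')
      fshuffle (ucm T) (ucm t) * << mmul (divcm F (ucm T)) (divcm F' (ucm t)) >>.
Proof.
move=> F0 F'0; rewrite [LHS]/fshuffle; have := forest_gt0 F0.
case e: (fsize F) => [//|p] _; rewrite addSn (shuffle_recS _ F0 F'0).
apply: (congr1 (GRing.scale _)).
apply: eq_big_seq => T TF; apply: eq_big_seq => t tF'.
have le_T := fsizeU_le TF; have le_t := fsizeU_le tF'.
rewrite fshuffle_step; apply: (congr1 ( *%R^~ _)); apply: tree_step_eq => G G' lt_G.
have := leq_trans lt_G (leq_add le_T le_t).
by rewrite e addSn => le_G; apply: shuffle_recE.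
Qed.

End ForestAlgebra.

Arguments forest_span R {W} P.

(* The (possibly non-associative) product [m] with unit [<< mone >>] makes   *)
(* the subspace [C] an algebra, and [z] is a morphism from it to [R].        *)
Definition is_algebra_morphism (R : realType) (W : choiceType)
    (C : {pred forest_alg R W})
    (m : forest_alg R W -> forest_alg R W -> forest_alg R W)
    (z : forest_alg R W -> R) : Prop :=
  [/\ submod_closed C, << mone >> \in C & {in C &, forall f g, m f g \in C}] /\
  [/\ forall c : R, {in C &, forall f g, z (c *: f + g) = c * z f + z g},
      z << mone >> = 1
    & {in C &, forall f g, z (m f g) = z f * z g}].

Definition Npos := {n : nat | (0 < n)%N}.

Lemma addNpos_subproof (a b : Npos) : (0 < val a + val b)%N.
Proof. by rewrite addn_gt0 (valP a). Qed.

Definition addNpos (a b : Npos) : Npos :=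
  exist (fun n => 0 < n)%N (val a + val b)%N (addNpos_subproof a b).

Section SeriesValues.
Local Open Scope classical_set_scope.
Local Open Scope ring_scope.
Variable R : realType.

Definition conv_st : pred (forest Npos) :=
  fun F => all (fun T => 1 < val (troot T))%N (trees F).

(* The truncation is [N + lambda], where [lambda] is -1 (strict inequalities) *)
(* if [star] is false and 0 (large inequalities) if it is true.              *)
Definition Zsum (star : bool) : forest Npos -> nat -> R :=
  forest_fold (fun (alpha : Npos) (f : nat -> R) (N : nat) =>
    \sum_(1 <= n < N + star) n%:R ^- val alpha * f n).

Lemma ZsumB star alpha F N :
  Zsum star (ucm (Bplus alpha F)) N =
  \sum_(1 <= n < N + star) n%:R ^- val alpha * Zsum star F n.
Proof. by rewrite /Zsum forest_foldB. Qed.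

Definition zeta_series (star : bool) : forest_alg R Npos -> R :=
  linext (fun F => lim (Zsum star F @ \oo) : R^o).

Definition zeta_st := zeta_series false.
Definition zeta_st_star := zeta_series true.

End SeriesValues.

Arguments zeta_st : clear implicits.
Arguments zeta_st_star : clear implicits.

Inductive letter := X | Y.

Definition is_Y (w : letter) : bool := if w is Y then true else false.
Definition letter_of (b : bool) : letter := if b then Y else X.
Lemma is_YK : cancel is_Y letter_of. Proof. by case. Qed.

HB.instance Definition _ := Choice.copy letter (can_type is_YK).

Section IntegralValues.
Local Open Scope classical_set_scope.
Local Open Scope ring_scope.
Variable R : realType.

Fixpoint leaves_branchings_Y (t : ptree letter) : bool :=
  let: PNode a s := t in
  ((size s == 0%N) || (1 < size s)%N ==> (a == Y)) && all leaves_branchings_Y s.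

Definition conv_sh : pred (forest letter) :=
  fun F => all (fun T => (troot T == X) && leaves_branchings_Y (val T)) (trees F).

Definition sigma (w : letter) (t : R) : R :=
  if w is X then t^-1 else (1 - t)^-1.

(* Meaningful at [z] such that [0 < e <= z < 1]. *)
Definition Aeps (e : R) : forest letter -> R -> R :=
  forest_fold (fun (w : letter) (f : R -> R) (z : R) =>
    (\int[lebesgue_measure]_(t in `[e, z]) (sigma w t * f t))%R).

Lemma AepsB e w F z :
  Aeps e (ucm (Bplus w F)) z =
  (\int[lebesgue_measure]_(t in `[e, z]) (sigma w t * Aeps e F t))%R.
Proof. by rewrite /Aeps forest_foldB. Qed.

Definition zeta_sh : forest_alg R letter -> R :=
  linext (fun F =>
    lim ((fun z : R => lim ((fun e : R => Aeps e F z) @ (0 : R)^'+))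
         @ (1 : R)^'-) : R^o).

End IntegralValues.

Arguments zeta_sh : clear implicits.

(* Main.v *)
Require Import Defs.
From HB Require Import structures.
From mathcomp Require Import all_boot all_order all_algebra finmap monalg.
From mathcomp Require Import zify ring lra.
From mathcomp Require Import all_classical all_reals all_analysis.

(** The truncated sums and the integrals from [e] are multiplicative maps on
    forests, built by iterating one operator per decoration: a weighted
    summation, or an integration against [sigma w].  These operators satisfy
    a Rota-Baxter identity,
      [phi a u * phi b v
         = phi a (u * phi b v) + phi b (phi a u * v)
           + lam * phi (op a b) (u * v)],
    which is the recursion of the [lam]-shuffle of two trees.  Splitting the
    square of summation [1 <= n, m < N + lambda] along its diagonal gives
    [lam = 1] for strict inner inequalities and [lam = -1] for large ones, the
    diagonal being then counted twice; for integrals it is the product rule,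
    and [lam = 0].  Hence, by induction on the number of vertices, the linear
    extension of such a map turns shuffles into products before any limit is
    taken ([fold_shuffle]); the averaging over pairs of trees in the shuffle
    of forests is harmless, all the terms having the same value.

    It remains to pass to the limit ([limit_shuffle]), which requires that
    the limits exist and that the shuffle of convergent forests be a
    combination of convergent forests ([shuffle_conv_st],
    [shuffle_conv_sh]).  All the quantities are nonnegative and monotone, so
    that existence is a matter of bounds.  A truncated sum with [k] vertices
    is at most the [k]-th power of the harmonic sum, and the series of
    [harm n ^+ k / n ^+ 2] converges by summation by parts
    ([harm_sqr_bounded]).  For integrals, put [g z = 1 - ln (1 - z)]:
    a nonempty forest with [k] vertices whose leaves are [Y] has an integral
    at most [z * g z ^+ k] ([Aeps_le]).  The factor [z] absorbs the pole of
    [sigma X] at 0 and gives the limit [e --> 0]; under a root [X] only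
    [g z ^+ k] is left to be integrated, which is integrable up to 1 and
    gives the limit [z --> 1] ([Aeps_bounded]). *)

Set Implicit Arguments.
Unset Strict Implicit.
Unset Printing Implicit Defensive.

Import Order.TTheory GRing.Theory Num.Theory.
Import numFieldNormedType.Exports.

Local Open Scope ring_scope.

(** * Linear extension and spans of forests *)

Section Linext.
Variables (R : realType) (W : choiceType).
Implicit Types (f g : forest_alg R W) (F G : forest W).

Lemma linext_is_linear (V : lmodType R) (phi : forest W -> V) :
  linear (linext phi).
Proof.
have linextEw (d : {fset forest W}) f : (msupp f `<=` d)%fset ->
    linext phi f = \sum_(F <- d) f@_F *: phi F.
  move=> fd; rewrite /linext (big_fset_incl _ fd) //= => F _ /mcoeff_outdom ->.
  by rewrite scale0r.
move=> c f g; set d := (msupp f `|` msupp g)%fset.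
rewrite !(linextEw d) ?fsubsetUl ?fsubsetUr //; last first.
  apply: fsubset_trans (msuppD_le _ _) _.
  by rewrite fsetSU // msuppZ_le.
rewrite scaler_sumr -big_split /=; apply: eq_bigr => F _.
by rewrite mcoeffD mcoeffZ scalerDl scalerA.
Qed.

HB.instance Definition _ (V : lmodType R) (phi : forest W -> V) :=
  GRing.isLinear.Build R (forest_alg R W) V _ (linext phi)
    (linext_is_linear phi).

Lemma linextU (V : lmodType R) (phi : forest W -> V) F :
  linext phi << F >> = phi F.
Proof. by rewrite /linext msuppU1 big_seq_fset1 mcoeffUU scale1r. Qed.

Lemma forest_algE f : f = \sum_(F <- msupp f) f@_F *: << F >>.
Proof.
rewrite {1}(monalgE f); apply: eq_bigr => F _.
by apply/malgP => G; rewrite [LHS]mcoeffU mcoeffZ mcoeffU1 mulr_natr.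
Qed.

Lemma forest_span_submod (P : pred (forest W)) :
  submod_closed (forest_span R P).
Proof.
split=> [|c f g /allP Pf /allP Pg]; first by rewrite unfold_in msupp0.
apply/allP => F /(fsubsetP (msuppD_le _ _)); rewrite in_fsetU.
by case/orP => [/(fsubsetP (msuppZ_le _ _)) /Pf //|/Pg].
Qed.

HB.instance Definition _ (P : pred (forest W)) :=
  GRing.isSubmodClosed.Build R (forest_alg R W) (forest_span R P)
    (forest_span_submod P).

Lemma forest_spanU (P : pred (forest W)) F : P F -> << F >> \in forest_span R P.
Proof. by move=> PF; apply/allP => G; rewrite msuppU1 in_fset1 => /eqP ->. Qed.

Lemma linext_span (V : lmodType R) (S : submodClosed V) (P : pred (forest W))
    (phi : forest W -> V) f :
  (forall F, P F -> phi F \in S) -> f \in forest_span R P -> linext phi f \in S.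
Proof.
move=> PS /allP Pf; rewrite /linext big_seq rpred_sum // => F /Pf PF.
by rewrite rpredZ // PS.
Qed.

Lemma mulU F G : << F >> * << G >> = << mmul F G >> :> forest_alg R W.
Proof. by rewrite malgM_def fgmulUU mulr1. Qed.

(** For a multiplicative [chi], concatenation is the product of the free
    algebra, so its linear extension is multiplicative. *)
Lemma linextM (chi : forest W -> R) f g :
  (forall F G, chi (mmul F G) = chi F * chi G) ->
  linext (chi : _ -> R^o) (f * g) =
    linext (chi : _ -> R^o) f * linext (chi : _ -> R^o) g.
Proof.
move=> chiM; rewrite {1}(forest_algE f) {1}(forest_algE g) mulr_suml linear_sum.
rewrite {2}/linext mulr_suml; apply: eq_bigr => F _.
rewrite mulr_sumr linear_sum mulr_sumr; apply: eq_bigr => G _.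
rewrite -scalerAl -scalerAr mulU !linearZ /= linextU chiM.
by rewrite /GRing.scale /= mulrACA mulrA.
Qed.

Lemma forest_spanM (P Q S : pred (forest W)) f g :
  (forall F G, P F -> Q G -> S (mmul F G)) ->
  f \in forest_span R P -> g \in forest_span R Q -> f * g \in forest_span R S.
Proof.
move=> PQ /allP Pf /allP Qg; rewrite (forest_algE f) (forest_algE g) mulr_suml.
rewrite big_seq rpred_sum // => F /Pf PF; rewrite mulr_sumr big_seq rpred_sum //.
move=> G /Qg QG; rewrite -scalerAl -scalerAr mulU !rpredZ //.
by apply: forest_spanU; exact: PQ.
Qed.

End Linext.

(** * Multiplicativity of Rota-Baxter characters *)

Section ForestInduction.
Variable W : choiceType.
Implicit Types F G : forest W.

(** Every tree is [Bplus a F] for a smaller forest [F], so that the three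
    operations below generate all forests. *)
Lemma forest_ind (P : forest W -> Prop) :
  P mone -> (forall F G, P F -> P G -> P (mmul F G)) ->
  (forall a F, P F -> P (ucm (Bplus a F))) -> forall F, P F.
Proof.
move=> P1 PM PB F; move: {2}(fsize F) (leqnn (fsize F)) => n.
elim: n F => [|n IH] F leF; rewrite -(treesK F) /forest_of big_seq;
  apply: big_ind => // T /fsizeU_le; rewrite (fsizeU T) => leT; first by lia.
by rewrite -(BplusK T); apply: PB; apply: IH; lia.
Qed.

Lemma mul_divU F T : T \in trees F -> mmul (ucm T) (divcm F (ucm T)) = F.
Proof.
rewrite -has_pred1 has_count count_trees => FT.
apply/eqP/cmP => U; rewrite cmM divcmE cmU.
by case: eqP => [<-|_]; rewrite ?subnKC ?add0n ?subn0.
Qed.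

End ForestInduction.

Section ShuffleCharacter.
Variables (R : realType) (W : choiceType) (lam : R) (op : W -> W -> W).
Implicit Types (F G : forest W).

(** The values of a map from forests to functions, extended linearly and read
    at a point: working pointwise lets the Rota-Baxter identity be required
    only on a domain [D], such as the interval where integrals make sense. *)
Definition eval_at (T : Type) (chi : forest W -> T -> R) (x : T) :
  forest_alg R W -> R := linext (fun F => chi F x : R^o).

Section EvalAt.
Variables (T : Type) (chi : forest W -> T -> R) (x : T).

Lemma eval_atU F : eval_at chi x << F >> = chi F x.
Proof. exact: linextU. Qed.

Lemma eval_atD f g : eval_at chi x (f + g) = eval_at chi x f + eval_at chi x g.
Proof. exact: linearD. Qed.

Lemma eval_atZ c f : eval_at chi x (c *: f) = c * eval_at chi x f.
Proof. exact: linearZ. Qed.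

Lemma eval_at_sum (I : eqType) (r : seq I) (f : I -> forest_alg R W) :
  eval_at chi x (\sum_(i <- r) f i) = \sum_(i <- r) eval_at chi x (f i).
Proof. exact: linear_sum. Qed.

Lemma eval_atM f g : (forall F G, chi (mmul F G) x = chi F x * chi G x) ->
  eval_at chi x (f * g) = eval_at chi x f * eval_at chi x g.
Proof. by move=> chiM; exact: (@linextM _ _ (chi ^~ x)). Qed.

End EvalAt.

(** The Rota-Baxter identity of weight [lam] has the same three terms as the
    recursion defining the shuffle of two trees, and it is transported through
    [phi] by the induction hypothesis.  For forests, each summand of the
    average factors as the value of the removed trees times the value of the
    remaining ones, whichever trees are chosen. *)
Lemma fold_shuffle (T : Type) (D : T -> Prop) (phi : W -> (T -> R) -> T -> R) :
    let chi := forest_fold phi in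
    (forall a u v, (forall y, D y -> u y = v y) ->
       forall x, D x -> phi a u x = phi a v x) ->
    (forall a g x, D x ->
       eval_at chi x (BplusL a g) = phi a (fun y => eval_at chi y g) x) ->
    (forall a b F G x, D x ->
       let U := phi a (chi F) in let V := phi b (chi G) in
       U x * V x = phi a (fun y => chi F y * V y) x
         + phi b (fun y => U y * chi G y) x
         + lam * phi (op a b) (fun y => chi F y * chi G y) x) ->
  forall F G x, D x ->
  eval_at chi x (fshuffle lam op F G) = chi F x * chi G x.
Proof.
move=> chi phi_ext phi_lin RB F G.
have chi1 x : chi mone x = 1 by rewrite /chi forest_fold1.
have chiM F1 F2 x : chi (mmul F1 F2) x = chi F1 x * chi F2 x.
  by rewrite /chi forest_foldM.
have chiU S : chi (ucm S) = phi (troot S) (chi (tsons S)).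
  by rewrite /chi -forest_foldB BplusK.
clearbody chi.
move: {2}(fsize F + fsize G)%N (leqnn (fsize F + fsize G)%N) => n.
elim: n F G => [|n IH] F G leFG x Dx.
  have [->|/forest_gt0 F0] := eqVneq F mone; last by lia.
  by rewrite fshuffle1F eval_atU chi1 mul1r.
have [->|F0] := eqVneq F mone.
  by rewrite fshuffle1F eval_atU chi1 mul1r.
have [->|G0] := eqVneq G mone.
  by rewrite fshuffleF1 eval_atU chi1 mulr1.
have treesE S t : S \in trees F -> t \in trees G ->
    eval_at chi x (fshuffle lam op (ucm S) (ucm t)) =
      chi (ucm S) x * chi (ucm t) x.
  move=> /fsizeU_le leS /fsizeU_le let_.
  have sS : fsize (ucm S) = (fsize (tsons S)).+1 := fsizeU S.
  have st : fsize (ucm t) = (fsize (tsons t)).+1 := fsizeU t.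
  have := RB (troot S) (troot t) (tsons S) (tsons t) x Dx.
  rewrite -(chiU S) -(chiU t) => ->.
  rewrite fshuffle_step /tree_step eval_atD eval_atD eval_atZ.
  congr (_ + _ + _); rewrite (phi_lin _ _ _ Dx).
  - by apply: phi_ext => // y Dy; apply: IH => //; lia.
  - by apply: phi_ext => // y Dy; apply: IH => //; lia.
  by congr (_ * _); apply: phi_ext => // y Dy; apply: IH => //; lia.
rewrite fshuffle_forests // eval_atZ eval_at_sum.
(* All the terms of the average are equal to the expected product. *)
transitivity ((size (trees F) * size (trees G))%N%:R^-1 *
   \sum_(T <- trees F) \sum_(t <- trees G) chi F x * chi G x).
  congr (_ * _); apply: eq_big_seq => S SF; rewrite eval_at_sum.
  apply: eq_big_seq => t tG.
  rewrite eval_atM // eval_atU treesE //.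
  have chiD H U : U \in trees H ->
      chi H x = chi (ucm U) x * chi (divcm H (ucm U)) x.
    by move=> UH; rewrite -{1}(mul_divU UH) (chiM (ucm U)).
  rewrite [RHS](congr2 *%R (chiD F S SF) (chiD G t tG)) mulrACA.
  by congr (_ * _); exact: chiM.
have szn0 : ((size (trees F) * size (trees G))%N%:R : R) != 0.
  by rewrite pnatr_eq0 muln_eq0 !size_eq0 !trees_eq0 negb_or F0.
rewrite !big_const_seq !count_predT !iter_addr_0 -mulrnA.
by rewrite (mulnC (size (trees G))) -(mulr_natl (_ * _)) mulKf.
Qed.

(** Since the shuffle is bilinear, everything can be checked on forests. *)
Lemma algebra_morphism_linext (P : pred (forest W)) (l : forest W -> R) :
    P mone -> l mone = 1 ->
    (forall F G, P F -> P G -> fshuffle lam op F G \in forest_span R P) ->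
    (forall F G, P F -> P G ->
       linext (l : _ -> R^o) (fshuffle lam op F G) = l F * l G) ->
  is_algebra_morphism (forest_span R P) (shuffle lam op) (linext (l : _ -> R^o)).
Proof.
move=> P1 l1 Psh lsh; split; split.
- exact: forest_span_submod.
- exact: forest_spanU.
- move=> f g Pf Pg; apply: linext_span Pf => F PF; apply: linext_span Pg => G PG.
  exact: Psh.
- by move=> c f g _ _; rewrite linearP.
- by rewrite linextU.
move=> f g /allP Pf /allP Pg.
pose z := eval_at (fun F (_ : unit) => l F) tt.
have zE h : z h = \sum_(F <- msupp h) h@_F * l F by [].
rewrite -[LHS]/(z _) -[RHS]/(z f * z g) /shuffle [X in z X]/linext.
rewrite {1}/z eval_at_sum.
rewrite (zE f) mulr_suml big_seq [RHS]big_seq; apply: eq_bigr => F /Pf PF.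
rewrite eval_atZ -mulrA; congr (_ * _); rewrite [X in eval_at _ _ X]/linext.
rewrite eval_at_sum (zE g) mulr_sumr big_seq [RHS]big_seq.
by apply: eq_bigr => G /Pg PG; rewrite eval_atZ mulrCA; congr (_ * _); exact: lsh.
Qed.

Local Open Scope classical_set_scope.
Local Open Scope ring_scope.

Lemma cvg_eval_at (T : Type) (D : set_system T) (FD : Filter D)
    (P : pred (forest W)) (chi : forest W -> T -> R) (l : forest W -> R) f :
    (forall F, P F -> chi F x @[x --> D] --> l F) ->
    f \in forest_span R P ->
  eval_at chi x f @[x --> D] --> (linext (l : _ -> R^o) f : R).
Proof.
move=> cvl /allP Pf; rewrite /eval_at /linext.
move: Pf; elim: (enum_fset (msupp f)) => [_|F s IH Ps].
  by rewrite big_nil; under eq_fun do rewrite big_nil; exact: cvg_cst.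
rewrite big_cons; under eq_fun do rewrite big_cons.
apply: cvgD; last by apply: IH => G Gs; apply: Ps; rewrite inE Gs orbT.
by apply: cvgMr; apply: cvl; apply: Ps; rewrite mem_head.
Qed.

(** A shuffle is a finite combination, so that multiplicativity along a filter
    survives in the limit as soon as every forest involved has a limit. *)
Lemma limit_shuffle (T : Type) (D : set_system T) (FD : ProperFilter D)
    (P : pred (forest W)) (chi : forest W -> T -> R) (l : forest W -> R) F G :
    (forall F, P F -> chi F x @[x --> D] --> l F) ->
    fshuffle lam op F G \in forest_span R P -> P F -> P G ->
    (\forall x \near D, eval_at chi x (fshuffle lam op F G) = chi F x * chi G x) ->
  linext (l : _ -> R^o) (fshuffle lam op F G) = l F * l G.
Proof.
move=> cvl Psh PF PG e.
have c1 := cvg_eval_at FD cvl Psh.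
have c2 : eval_at chi x (fshuffle lam op F G) @[x --> D] --> l F * l G.
  have : chi F x * chi G x @[x --> D] --> l F * l G.
    by apply: cvgM; exact: cvl.
  apply: cvg_trans; apply: near_eq_cvg.
  by apply: filterS e => x ->.
exact: cvg_unique c1 c2.
Qed.

End ShuffleCharacter.

(** * Stability of convergent forests under shuffles *)

Section Closure.
Variables (R : realType) (W : choiceType).
Implicit Types (F G : forest W) (S T : tree W) (f : forest_alg R W).

Lemma forest_span_predI (P Q : pred (forest W)) f :
  f \in forest_span R P -> f \in forest_span R Q ->
  f \in forest_span R (predI P Q).
Proof. by rewrite !unfold_in all_predI => -> ->. Qed.

Lemma forest_spanS (P Q : pred (forest W)) f : {subset P <= Q} ->
  f \in forest_span R P -> f \in forest_span R Q.
Proof. by move=> PQ; apply: sub_all => F /PQ. Qed.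

Lemma BplusL_span (P Q : pred (forest W)) a f :
  (forall F, P F -> Q (ucm (Bplus a F))) ->
  f \in forest_span R P -> BplusL a f \in forest_span R Q.
Proof. by move=> PQ; apply: linext_span => F /PQ; exact: forest_spanU. Qed.

Definition all_trees (p : pred (tree W)) : pred (forest W) :=
  fun F => all p (trees F).

Lemma all_treesM p F G :
  all_trees p (mmul F G) = all_trees p F && all_trees p G.
Proof. by rewrite /all_trees (perm_all _ (perm_treesM F G)) all_cat. Qed.

Lemma all_treesU p T : all_trees p (ucm T) = p T.
Proof. by rewrite /all_trees treesU all_seq1. Qed.

Lemma all_trees_div p F T : T \in trees F -> all_trees p F ->
  all_trees p (divcm F (ucm T)).
Proof. by move=> TF; rewrite -{1}(mul_divU TF) all_treesM => /andP[]. Qed.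

(** The shuffle of two forests only replaces one tree of each by their shuffle,
    hence a condition bearing on trees separately need only be checked there. *)
Lemma shuffle_all_trees lam op (p : pred (tree W)) F G :
    (forall S T, S \in trees F -> T \in trees G -> p S -> p T ->
       fshuffle lam op (ucm S) (ucm T) \in forest_span R (all_trees p)) ->
  all_trees p F -> all_trees p G ->
  fshuffle lam op F G \in forest_span R (all_trees p).
Proof.
move=> pST pF pG; have [->|F0] := eqVneq F mone.
  by rewrite fshuffle1F forest_spanU.
have [->|G0] := eqVneq G mone; first by rewrite fshuffleF1 forest_spanU.
rewrite fshuffle_forests // rpredZ // big_seq rpred_sum // => S SF.
rewrite big_seq rpred_sum // => T TG.
have pS : p S by move/allP: pF; apply.
have pT : p T by move/allP: pG; apply.
apply: (@forest_spanM _ _ (all_trees p) (all_trees p)); last 2 first.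
- exact: pST.
- apply: forest_spanU; rewrite all_treesM; apply/andP.
  by split; exact: all_trees_div.
by move=> F1 F2 p1 p2; rewrite all_treesM p1.
Qed.

(** The roots of a shuffle of two trees are [a], [b] and, when [lam] is nonzero,
    [op a b]. *)
Lemma shuffle_roots lam op (q : pred W) F G :
    (lam != 0 -> forall a b, q a -> q b -> q (op a b)) ->
    let p := fun T => q (troot T) in all_trees p F -> all_trees p G ->
  fshuffle lam op F G \in forest_span R (all_trees p).
Proof.
move=> qop p; apply: shuffle_all_trees => S T _ _ pS pT.
have BqP a f : q a -> BplusL a f \in forest_span R (all_trees p).
  move=> qa; apply: (@BplusL_span predT) => [F0 _|].
    by rewrite all_treesU /p troot_Bplus.
  exact: all_predT.
rewrite fshuffle_step /tree_step; apply: rpredD.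
  by apply: rpredD; apply: BqP.
have [->|lam0] := eqVneq lam 0; first by rewrite scale0r rpred0.
by apply: rpredZ; apply: BqP; apply: qop.
Qed.

Lemma shuffle_trees_single lam op S T :
  fshuffle lam op (ucm S) (ucm T) \in
    forest_span R (fun F => size (trees F) == 1%N).
Proof.
have Bs a f : BplusL a f \in forest_span R (fun F => size (trees F) == 1%N).
  apply: (@BplusL_span predT) => [F0 _|]; first by rewrite treesU.
  exact: all_predT.
by rewrite fshuffle_step /tree_step !rpredD // ?rpredZ.
Qed.

End Closure.

Section ConvShuffle.
Variable R : realType.
Implicit Types (F G : forest letter) (S T : tree letter).

Lemma leaves_branchings_Y_norm t :
  leaves_branchings_Y (norm t) = leaves_branchings_Y t.
Proof.
elim/ptree_ind': t => a s IH /=.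
have p := perm_canon (map (@norm _) s).
rewrite -(perm_size p) -(perm_all _ p) size_map all_map; congr (_ && _).
by elim: IH => //= u s' -> _ ->.
Qed.

(** Convergence without the condition on the roots: unlike [conv_sh] it is
    inherited by subtrees, which inductions require. *)
Definition leaves_Y : pred (forest letter) :=
  all_trees (fun T => leaves_branchings_Y (val T)).

Lemma leaves_branchings_Y_Bplus a F :
  leaves_branchings_Y (val (Bplus a F)) =
    ((size (trees F) != 1%N) ==> (a == Y)) && leaves_Y F.
Proof.
rewrite [val _]/= -/(norm (PNode a _)) leaves_branchings_Y_norm /= size_map.
by rewrite all_map; case: (size _) => [|[]].
Qed.

(** A new root [a] is grafted on [fshuffle (tsons S) (ucm T)].  If [a] is [Y],
    any number of children is allowed; if [a] is [X], then [tsons S] is a single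
    tree, so that the shuffle is a combination of single trees and the new root
    is neither a leaf nor a branching vertex. *)
Lemma shuffle_leaves_Y op F G : leaves_Y F -> leaves_Y G ->
  fshuffle 0 op F G \in forest_span R leaves_Y.
Proof.
move: {2}(fsize F + fsize G)%N (leqnn (fsize F + fsize G)%N) => n.
elim: n F G => [|n IH] F G leFG; apply: shuffle_all_trees => S T /fsizeU_le leS
   /fsizeU_le leT; have sS : fsize (ucm S) = (fsize (tsons S)).+1 := fsizeU S;
   have sT : fsize (ucm T) = (fsize (tsons T)).+1 := fsizeU T; first by lia.
have BY a (f : forest_alg R letter) :
   (a == Y) || (f \in forest_span R (fun F => size (trees F) == 1%N)) ->
   f \in forest_span R leaves_Y -> BplusL a f \in forest_span R leaves_Y.
  move=> /orP[/eqP -> | f1] fY.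
    apply: BplusL_span fY => F0 F0Y.
    by rewrite /leaves_Y all_treesU leaves_branchings_Y_Bplus eqxx implybT.
  apply: BplusL_span (forest_span_predI f1 fY) => F0 /andP[/= F01 F0Y].
  by rewrite /leaves_Y all_treesU leaves_branchings_Y_Bplus F01.
have single H : size (trees H) == 1%N -> exists U, H = ucm U.
  case e: (trees H) => [|U [|]] // _; exists U.
  by rewrite -(treesK H) e /forest_of big_seq1.
have eqS : leaves_branchings_Y (val S) =
    ((size (trees (tsons S)) != 1%N) ==> (troot S == Y)) && leaves_Y (tsons S).
  by rewrite -{1}(BplusK S) leaves_branchings_Y_Bplus.
have eqT : leaves_branchings_Y (val T) =
    ((size (trees (tsons T)) != 1%N) ==> (troot T == Y)) && leaves_Y (tsons T).
  by rewrite -{1}(BplusK T) leaves_branchings_Y_Bplus.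
rewrite eqS eqT => /andP[S1 SY] /andP[T1 TY].
have SU : leaves_Y (ucm S) by rewrite /leaves_Y all_treesU eqS S1.
have TU : leaves_Y (ucm T) by rewrite /leaves_Y all_treesU eqT T1.
rewrite fshuffle_step /tree_step scale0r addr0; apply: rpredD; apply: BY.
- case: (troot S =P Y) S1 => [//|_]; rewrite implybF negbK => /single[U ->].
  exact: shuffle_trees_single.
- by apply: IH => //; lia.
- case: (troot T =P Y) T1 => [//|_]; rewrite implybF negbK => /single[U ->].
  exact: shuffle_trees_single.
- by apply: IH => //; lia.
Qed.

Lemma shuffle_conv_sh op F G : conv_sh F -> conv_sh G ->
  fshuffle 0 op F G \in forest_span R conv_sh.
Proof.
pose p T := troot T == X.
have convE H : conv_sh H = all_trees p H && leaves_Y H by rewrite -all_predI.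
rewrite !convE => /andP[pF yF] /andP[pG yG].
apply: (@forest_spanS _ _ (predI (all_trees p) leaves_Y)) => [H pyH|].
  by rewrite -[_ \in _]/(conv_sh H) convE.
apply: forest_span_predI; last exact: shuffle_leaves_Y.
by apply: (@shuffle_roots _ _ 0 op (fun w => w == X)) => //; rewrite eqxx.
Qed.

Lemma shuffle_conv_st lam (F G : forest Npos) : conv_st F -> conv_st G ->
  fshuffle lam addNpos F G \in forest_span R conv_st.
Proof.
apply: (@shuffle_roots _ _ lam addNpos (fun a => 1 < val a)%N) => _ a b.
by move=> a1 b1; rewrite /= (leq_trans a1) // leq_addr.
Qed.

End ConvShuffle.

(** * Truncated sums and their convergence *)

Section Series.
Variable R : realType.
Local Open Scope classical_set_scope.
Local Open Scope ring_scope.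

(** The square of summation is cut along its diagonal.  With large inner
    inequalities both triangles contain the diagonal, hence the sign. *)
Lemma mul_sum_nat (star : bool) (a b : nat -> R) M :
  (\sum_(1 <= n < M) a n) * (\sum_(1 <= n < M) b n) =
  \sum_(1 <= n < M) a n * (\sum_(1 <= m < n + star) b m)
  + \sum_(1 <= n < M) (\sum_(1 <= m < n + star) a m) * b n
  + (if star then -1 else 1) * \sum_(1 <= n < M) a n * b n.
Proof.
elim: M => [|[_|M IH]]; try by rewrite !big_geq // !(mulr0, addr0).
rewrite !(big_nat_recr M.+1) //= mulrDl !mulrDr IH.
case: star {IH}; rewrite ?addn0 ?addn1; last by ring.
by rewrite !(big_nat_recr M.+1) //=; ring.
Qed.

Lemma Zsum_shuffle star F G N :
  eval_at (Zsum R star) N (fshuffle (if star then -1 else 1) addNpos F G) =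
  Zsum R star F N * Zsum R star G N.
Proof.
apply: (@fold_shuffle _ _ _ _ _ (fun=> True)) => //
  [a u v uv x _|a g x _|a b F1 G1 x _ /=].
- by apply: eq_bigr => n _; rewrite uv.
- rewrite /BplusL /linext eval_at_sum.
  under [RHS]eq_bigr => n _ do rewrite [X in _ * X]/eval_at /linext mulr_sumr.
  rewrite exchange_big /=; apply: eq_bigr => F1 _.
  rewrite eval_atZ eval_atU forest_foldB mulr_sumr; apply: eq_bigr => n _.
  by rewrite mulrCA.
rewrite (mul_sum_nat star); congr (_ + _ + _ * _); apply: eq_bigr => n _.
- by rewrite mulrA.
- by rewrite mulrCA.
by rewrite exprD invfM; ring.
Qed.

Definition harm (N : nat) : R := \sum_(1 <= n < N.+1) n%:R^-1.

Lemma harmS N : harm N.+1 = harm N + N.+1%:R^-1.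
Proof. by rewrite /harm big_nat_recr. Qed.

Lemma harm_ge0 N : 0 <= harm N.
Proof. by rewrite sumr_ge0. Qed.

Lemma ler_harm M N : (M <= N)%N -> harm M <= harm N.
Proof.
elim: N => [|N IH]; first by rewrite leqn0 => /eqP ->.
rewrite leq_eqVlt => /predU1P[-> //|/IH]; rewrite harmS => /le_trans; apply.
by rewrite lerDl.
Qed.

Lemma ler_subrX (x y : R) k : 0 <= x -> x <= y ->
  y ^+ k.+1 - x ^+ k.+1 <= k.+1%:R * (y - x) * y ^+ k.
Proof.
move=> x0 xy; have y0 := le_trans x0 xy.
elim: k => [|k IH]; first by rewrite !expr1 expr0 mulr1 mul1r.
have -> : y ^+ k.+2 - x ^+ k.+2 = y * (y ^+ k.+1 - x ^+ k.+1) + (y - x) * x ^+ k.+1.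
  by rewrite !exprS; ring.
have -> : k.+2%:R * (y - x) * y ^+ k.+1 =
    y * (k.+1%:R * (y - x) * y ^+ k) + (y - x) * y ^+ k.+1.
  by rewrite !exprS -(natr1 k.+1); ring.
apply: lerD; first exact: ler_wpM2l.
by apply: ler_wpM2l; rewrite ?subr_ge0 // lerXn2r // nnegrE.
Qed.

Definition harm_sqr k N : R := \sum_(1 <= n < N.+1) n%:R ^- 2 * harm n ^+ k.

(** The inequality [1 / n ^+ 2 <= 2 * (1 / n - 1 / n.+1)], which replaces the
    weights of the series by telescoping ones. *)
Lemma inv_sqr_telescope N : N.+1%:R ^- 2 + 2 / N.+2%:R <= 2 / N.+1%:R :> R.
Proof.
rewrite -subr_ge0 -(natr1 N.+1) -[N.+1%:R]natr1; set x : R := N%:R.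
have x0 : 0 <= x by rewrite ler0n.
have -> : 2 / (x + 1) - ((x + 1) ^- 2 + 2 / (x + 1 + 1)) =
   x / ((x + 1) ^+ 2 * (x + 1 + 1)).
  by field; apply/andP; split; lra.
by rewrite divr_ge0 // mulr_ge0 ?sqr_ge0 //; lra.
Qed.

(** Summation by parts: after the telescoping bound on the weights, the
    difference of consecutive values of [harm n ^+ k.+1] is at most
    [k.+1 * harm n ^+ k / n].  The second term on the left is the boundary
    term, kept for the sake of the induction on [N]. *)
Lemma harm_sqr_step k N :
  harm_sqr k.+1 N + 2 * harm N ^+ k.+1 / N.+1%:R <= 2 * k.+1%:R * harm_sqr k N.
Proof.
elim: N => [|N IH].
  by rewrite /harm_sqr /harm !big_geq // exprS mul0r !(mulr0, mul0r) addr0.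
have SS j : harm_sqr j N.+1 = harm_sqr j N + N.+1%:R ^- 2 * harm N.+1 ^+ j.
  by rewrite /harm_sqr big_nat_recr.
rewrite !SS.
have le1 := ler_subrX k (harm_ge0 N) (ler_harm (leqnSn N)).
have le2 := ler_wpM2r (exprn_ge0 k.+1 (harm_ge0 N.+1)) (inv_sqr_telescope N).
have d : harm N.+1 - harm N = N.+1%:R^-1 by rewrite harmS addrC addKr.
rewrite d in le1.
have le3 : 2 / N.+1%:R * _ <= 2 / N.+1%:R * _ :=
  ler_wpM2l (divr_ge0 (ler0n R 2) (ler0n R N.+1)) le1.
set u := harm N.+1 ^+ k.+1 in le2 le3 *; set v := harm N ^+ k.+1 in IH le3 *.
have e2 : N.+1%:R ^- 2 = N.+1%:R^-1 * N.+1%:R^-1 :> R by rewrite expr2 invfM.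
rewrite {}e2 {le1 d} in le2 *; move: IH le2 le3; set w := harm N.+1 ^+ k.
set i := N.+1%:R^-1; set j := N.+2%:R^-1.
move: (harm_sqr k.+1 N) (harm_sqr k N) k.+1%:R => s1 s0 K; lra.
Qed.

Lemma harm_sqr_bounded k : exists C : R, forall N, harm_sqr k N <= C.
Proof.
elim: k => [|k [C SC]].
  exists 2 => N; suff : harm_sqr 0 N + 2 / N.+1%:R <= 2.
    by apply: le_trans; rewrite lerDl divr_ge0.
  elim: N => [|N IH]; first by rewrite /harm_sqr big_geq // add0r divr1.
  rewrite /harm_sqr big_nat_recr //= -/(harm_sqr 0 N) expr0 mulr1 -addrA.
  by apply: le_trans IH; rewrite lerD2l inv_sqr_telescope.
exists (2 * k.+1%:R * C) => N.
apply: le_trans (_ : 2 * k.+1%:R * harm_sqr k N <= _); last by apply: ler_wpM2l.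
apply: le_trans (harm_sqr_step k N); rewrite lerDl divr_ge0 //.
by rewrite mulr_ge0 // exprn_ge0 // harm_ge0.
Qed.

Lemma Zsum1 star N : Zsum R star mone N = 1.
Proof. by rewrite /Zsum forest_fold1. Qed.

Lemma ZsumM star F G N :
  Zsum R star (mmul F G) N = Zsum R star F N * Zsum R star G N.
Proof. by rewrite /Zsum forest_foldM. Qed.

Lemma Zsum_ge0 star F N : 0 <= Zsum R star F N.
Proof.
elim/forest_ind: F N => [|F G IF IG|a F IF] N.
- by rewrite Zsum1.
- by rewrite ZsumM mulr_ge0.
by rewrite ZsumB sumr_ge0 // => n _; rewrite mulr_ge0 // invr_ge0 exprn_ge0.
Qed.

Lemma ler_sum_star (star : bool) (u v : nat -> R) N :
  (forall n, 0 <= v n) -> (forall n, (0 < n <= N)%N -> u n <= v n) ->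
  \sum_(1 <= n < N + star) u n <= \sum_(1 <= n < N.+1) v n.
Proof.
move=> v0 uv; apply: le_trans (_ : \sum_(1 <= n < N + star) v n <= _).
  rewrite big_nat [leRHS]big_nat; apply: ler_sum => n ?; apply: uv.
  by case: (star) => *; lia.
case: star; rewrite ?addn1 ?addn0 //.
by case: N {uv} => [|N]; [rewrite !big_geq | rewrite [leRHS]big_nat_recr //= lerDl].
Qed.

(** Each vertex contributes at most one harmonic sum, since decorations are
    positive. *)
Lemma Zsum_le star F N : Zsum R star F N <= harm N ^+ fsize F.
Proof.
elim/forest_ind: F N => [|F G IF IG|a F IF] N.
- by rewrite Zsum1 /fsize trees1 big_nil.
- by rewrite ZsumM fsizeM exprD ler_pM ?Zsum_ge0.
rewrite ZsumB fsizeU tsons_Bplus exprS /harm mulr_suml.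
apply: ler_sum_star => n; first by rewrite mulr_ge0 // exprn_ge0 // harm_ge0.
move=> /andP[n0 nN]; apply: ler_pM; rewrite ?Zsum_ge0 ?invr_ge0 ?exprn_ge0 //.
  rewrite lef_pV2 ?posrE ?exprn_gt0 ?ltr0n // -[leLHS]expr1 ler_weXn2l ?ler1n //.
  exact: (valP a).
apply: le_trans (IF n) _.
by rewrite lerXn2r ?nnegrE ?harm_ge0 // ler_harm.
Qed.

(** A root decorated by at least 2 turns the bound on the sum over its children
    into a convergent series. *)
Lemma Zsum_cvg star F : conv_st F -> cvgn (Zsum R star F).
Proof.
move=> /allP cF; rewrite -(treesK F) /forest_of big_seq.
apply: (big_ind (fun F0 => cvgn (Zsum R star F0))) => [|F1 F2 c1 c2|T TF].
- rewrite (_ : Zsum R star mone = cst 1); first exact: is_cvg_cst.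
  by apply/funext => N; rewrite Zsum1.
- rewrite (_ : Zsum R star _ = Zsum R star F1 \* Zsum R star F2).
    exact: is_cvgM.
  by apply/funext => N; rewrite ZsumM.
have := cF _ TF; rewrite -(BplusK T) troot_Bplus; set a := troot T => a1.
apply: nondecreasing_is_cvgn.
  apply/nondecreasing_seqP => n; rewrite !ZsumB addSn.
  case: (n + star)%N => [|m]; first by rewrite !big_geq.
  rewrite [leRHS]big_nat_recr //= lerDl mulr_ge0 ?Zsum_ge0 //.
have [C SC] := harm_sqr_bounded (fsize (tsons T)).
exists C => _ [N _ <-]; apply: le_trans (SC N); rewrite ZsumB /harm_sqr.
apply: ler_sum_star => n.
  by rewrite mulr_ge0 ?invr_ge0 ?exprn_ge0 ?harm_ge0.
move=> /andP[n0 nN]; apply: ler_pM;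
  rewrite ?Zsum_ge0 ?Zsum_le ?invr_ge0 ?exprn_ge0 //.
by rewrite lef_pV2 ?posrE ?exprn_gt0 ?ltr0n // ler_weXn2l ?ler1n.
Qed.

Lemma zeta_series_morphism star :
  is_algebra_morphism (forest_span R conv_st)
    (shuffle (if star then -1 else 1) addNpos) (@zeta_series R star).
Proof.
apply: algebra_morphism_linext => [||F G|F G cF cG].
- by rewrite /conv_st trees1.
- rewrite (_ : Zsum R star mone = cst 1).
    by apply: lim_cst; exact: Rhausdorff.
  by apply/funext => N; rewrite Zsum1.
- exact: shuffle_conv_st.
apply: (@limit_shuffle _ _ _ _ nat \oo _ conv_st (Zsum R star)) => //.
- by move=> F1 /Zsum_cvg; exact.
- exact: shuffle_conv_st.
by apply: nearW => N; exact: Zsum_shuffle.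
Qed.

End Series.

(** * Primitives on a half-open interval *)

Section HalfOpenCalculus.
Variable R : realType.
Local Open Scope classical_set_scope.
Local Open Scope ring_scope.
Implicit Types (e x z : R) (f g u v U V : R -> R).
Local Notation mu := (@lebesgue_measure R).

(** Continuity on [[e, 1[]: this is where the integrals from [e] live, and no
    control is available at 1. *)
Definition continuous_co e u :=
  u x @[x --> e^'+] --> u e /\ forall x, e < x < 1 -> {for x, continuous u}.

Lemma continuous_coM e u v : continuous_co e u -> continuous_co e v ->
  continuous_co e (fun t => u t * v t).
Proof.
by move=> [u1 u2] [v1 v2]; split=> [|x x1]; apply: cvgM => //;
  [exact: u2 | exact: v2].
Qed.

Lemma continuous_coD e u v : continuous_co e u -> continuous_co e v ->
  continuous_co e (fun t => u t + v t).
Proof.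
by move=> [u1 u2] [v1 v2]; split=> [|x x1]; apply: cvgD => //;
  [exact: u2 | exact: v2].
Qed.

Lemma continuous_co_cst e c : continuous_co e (fun=> c).
Proof. by split=> *; exact: cvg_cst. Qed.

Lemma continuous_coW e a u :
  e <= a -> a < 1 -> continuous_co e u -> continuous_co a u.
Proof.
rewrite le_eqVlt => /predU1P[-> //|ea a1] [_ uc]; split=> [|x /andP[ax x1]].
  by apply: cvg_at_right_filter; apply: uc; rewrite ea.
by apply: uc; rewrite (lt_trans ea ax).
Qed.

Lemma continuous_co_within e z u : e < z -> z < 1 -> continuous_co e u ->
  {within `[e, z], continuous u}.
Proof.
move=> ez z1 [ur uc]; apply/(continuous_within_itvP _ ez); split=> //.
  move=> x; rewrite in_itv /= => /andP[ex xz].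
  by apply: uc; rewrite ex (lt_trans xz).
by apply: cvg_at_left_filter; apply: uc; rewrite ez.
Qed.

Lemma derive_continuous_co e u u' : e < 1 ->
  (forall x, x < 1 -> is_derive x (1 : R) u (u' x)) -> continuous_co e u.
Proof.
move=> e1 du; have uc x : x < 1 -> {for x, continuous u}.
  move=> /du [d _]; apply: differentiable_continuous; exact/derivable1_diffP.
split=> [|x /andP[_ x1]]; last exact: uc.
by apply: cvg_at_right_filter; exact: uc.
Qed.

(** Inequalities between primitives, and with [primitive_uniq] identities as
    well, are all deduced from the comparison of derivatives. *)
Lemma ler_derive e z f g f' g' :
    continuous_co e f -> continuous_co e g ->
    (forall x, e < x < 1 -> is_derive x (1 : R) f (f' x)) ->
    (forall x, e < x < 1 -> is_derive x (1 : R) g (g' x)) ->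
    (forall x, e < x < 1 -> f' x <= g' x) ->
  f e <= g e -> e <= z < 1 -> f z <= g z.
Proof.
move=> fc gc df dg le_fg fge /andP[].
rewrite le_eqVlt => /predU1P[<- //|ez z1].
have d x : x \in `]e, z[ -> is_derive x (1 : R) (g - f) (g' x - f' x).
  rewrite in_itv /= => /andP[ex xz].
  have ex1 : e < x < 1 by rewrite ex (lt_trans xz).
  by apply: is_deriveB; [exact: dg | exact: df].
have := @ger0_derive1_ndecr R (g - f) e z _ _ _ e z (lexx e) (ltW ez) (lexx z).
suff H : g e - f e <= g z - f z -> f z <= g z.
  move=> h; apply: H; apply: h.
  - by move=> x /d [].
  - move=> x xez; have [_] := d x xez; rewrite derive1E => ->; rewrite subr_ge0.
    move: xez; rewrite in_itv /= => /andP[ex xz].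
    by apply: le_fg; rewrite ex (lt_trans xz).
  - apply: (@continuous_co_within e z (fun t => g t - f t)) => //.
    case: fc gc => [f1 f2] [g1 g2]; split=> [|x x1]; apply: cvgB => //;
     [exact: g2 | exact: f2].
by move=> h; rewrite -subr_ge0 (le_trans _ h) // subr_ge0.
Qed.

Definition primitive_co e U u := [/\ continuous_co e U, U e = 0
  & forall x, e < x < 1 -> is_derive x (1 : R) U (u x)].

Lemma primitive_uniq e U V u v z : primitive_co e U u -> primitive_co e V v ->
  (forall x, e < x < 1 -> u x = v x) -> e <= z < 1 -> U z = V z.
Proof.
move=> [Uc U0 dU] [Vc V0 dV] uv ez; apply/eqP; rewrite eq_le; apply/andP; split.
  by apply: (ler_derive Uc Vc dU dV) => // [x /uv -> //|]; rewrite U0 V0.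
by apply: (ler_derive Vc Uc dV dU) => // [x /uv -> //|]; rewrite U0 V0.
Qed.

(** The fundamental theorem of calculus, by which identities and bounds between
    integrals become statements on their derivatives. *)
Lemma primitive_integral e u : e < 1 -> continuous_co e u ->
  primitive_co e (fun z => (\int[mu]_(t in `[e, z]) u t)%R) u.
Proof.
move=> e1 uc.
have ui z : e < z -> z < 1 -> mu.-integrable `[e, z] (EFin \o u).
  move=> ez z1; apply: continuous_compact_integrable; first exact: segment_compact.
  exact: continuous_co_within.
have U0 : (\int[mu]_(t in `[e, e]) u t)%R = 0 by rewrite set_itv1 Rintegral_set1.
have d x : e < x < 1 ->
    is_derive x (1 : R) (fun z => (\int[mu]_(t in `[e, z]) u t)%R) (u x).
  move=> /andP[ex x1]; have [y /andP[xy y1]] : exists y, x < y < 1.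
    by exists ((x + 1) / 2); rewrite midf_lt // midf_lt.
  have [] := @continuous_FTC1_closed R u e x y xy (ui y (lt_trans ex xy) y1) ex.
    by apply: uc.2; rewrite ex.
  by move=> dU U'; exact: (DeriveDef dU (etrans (esym (derive1E _ _)) U')).
split=> //; split=> [|x /d [dU _]]; last first.
  by apply: differentiable_continuous; exact/derivable1_diffP.
rewrite U0; apply: cvg_at_right_filter.
have e2 : e < (e + 1) / 2 by rewrite midf_lt.
by apply: (parameterized_integral_cvg_left e2); apply: ui => //; rewrite midf_lt.
Qed.

Lemma primitiveD e U V u v : primitive_co e U u -> primitive_co e V v ->
  primitive_co e (fun t => U t + V t) (fun t => u t + v t).
Proof.
move=> [Uc U0 dU] [Vc V0 dV]; split; first exact: continuous_coD.
  by rewrite U0 V0 addr0.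
by move=> x x1; apply: is_deriveD; [exact: dU | exact: dV].
Qed.

Lemma primitiveZ e c U u : primitive_co e U u ->
  primitive_co e (fun t => c * U t) (fun t => c * u t).
Proof.
move=> [Uc U0 dU]; split.
- by apply: continuous_coM => //; exact: continuous_co_cst.
- by rewrite U0 mulr0.
by move=> x x1; apply: is_deriveZ; exact: dU.
Qed.

Lemma primitive0 e : primitive_co e (fun=> 0) (fun=> 0).
Proof. by split=> // [|x _]; [exact: continuous_co_cst | exact: is_derive_cst]. Qed.

Lemma primitiveM e U V u v : primitive_co e U u -> primitive_co e V v ->
  primitive_co e (fun t => U t * V t) (fun t => u t * V t + U t * v t).
Proof.
move=> [Uc U0 dU] [Vc V0 dV]; split; first exact: continuous_coM.
  by rewrite U0 mul0r.
move=> x x1; apply: (is_derive_eq (is_deriveM (dU x x1) (dV x x1))).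
by rewrite /GRing.scale /= addrC mulrC.
Qed.

End HalfOpenCalculus.

(** * Multiplicativity of iterated integrals *)

Section IteratedIntegrals.
Variable R : realType.
Local Open Scope classical_set_scope.
Local Open Scope ring_scope.
Implicit Types (e z : R) (F G : forest letter).

Lemma sigma_co e w : 0 < e < 1 -> continuous_co e (sigma w : R -> R).
Proof.
move=> /andP[e0 e1].
have sc x : 0 < x < 1 -> {for x, continuous (sigma w : R -> R)}.
  move=> /andP[x0 x1]; rewrite /continuous_at; case: w => /=; apply: cvgV.
  - exact: lt0r_neq0.
  - exact: cvg_id.
  - by rewrite gt_eqF // subr_gt0.
  - by apply: cvgB; [exact: cvg_cst | exact: cvg_id].
split=> [|x /andP[ex x1]]; last by apply: sc; rewrite (lt_trans e0).
by apply: cvg_at_right_filter; apply: sc; rewrite e0.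
Qed.

Lemma Aeps1 e z : Aeps e mone z = 1.
Proof. by rewrite /Aeps forest_fold1. Qed.

Lemma AepsM e F G z : Aeps e (mmul F G) z = Aeps e F z * Aeps e G z.
Proof. by rewrite /Aeps forest_foldM. Qed.

Lemma primitive_fold e w (u : R -> R) : 0 < e < 1 -> continuous_co e u ->
  primitive_co e
    (fun z => (\int[lebesgue_measure]_(t in `[e, z]) (sigma w t * u t))%R)
    (fun t => sigma w t * u t).
Proof.
move=> e01 uc; apply: primitive_integral; first by case/andP: e01.
by apply: continuous_coM => //; exact: sigma_co.
Qed.

Lemma AepsBE e w F : Aeps e (ucm (Bplus w F)) =
  (fun z => (\int[lebesgue_measure]_(t in `[e, z]) (sigma w t * Aeps e F t))%R).
Proof. by apply/funext => z; rewrite AepsB. Qed.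

Lemma Aeps_co e F : 0 < e < 1 -> continuous_co e (Aeps e F).
Proof.
move=> e01; elim/forest_ind: F => [|F G IF IG|w F IF].
- rewrite (_ : Aeps e mone = fun=> 1); first exact: continuous_co_cst.
  by apply/funext => z; rewrite Aeps1.
- rewrite (_ : Aeps e _ = fun z => Aeps e F z * Aeps e G z).
    exact: continuous_coM.
  by apply/funext => z; rewrite AepsM.
by rewrite AepsBE; case: (primitive_fold w e01 IF).
Qed.

Lemma Aeps_primitive e w F : 0 < e < 1 ->
  primitive_co e (Aeps e (ucm (Bplus w F))) (fun t => sigma w t * Aeps e F t).
Proof.
by move=> e01; rewrite AepsBE; apply: primitive_fold => //; exact: Aeps_co.
Qed.

Lemma eval_at_Aeps_co e (g : forest_alg R letter) : 0 < e < 1 ->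
  continuous_co e (fun z => eval_at (@Aeps R e) z g).
Proof.
move=> e01; rewrite /eval_at /linext; elim: (enum_fset (msupp g)) => [|F s IH].
  by under eq_fun do rewrite big_nil; exact: continuous_co_cst.
under eq_fun do rewrite big_cons; apply: continuous_coD => //.
by apply: continuous_coM; [exact: continuous_co_cst | exact: Aeps_co].
Qed.

(** The form in which linearity of integration enters [fold_shuffle]. *)
Lemma eval_at_BplusL_primitive e w (g : forest_alg R letter) : 0 < e < 1 ->
  primitive_co e (fun z => eval_at (@Aeps R e) z (BplusL w g))
    (fun t => sigma w t * eval_at (@Aeps R e) t g).
Proof.
move=> e01; rewrite /BplusL /linext.
under eq_fun => z do
  (rewrite eval_at_sum; under eq_bigr => F _ do rewrite eval_atZ eval_atU).
rewrite /eval_at /linext; elim: (enum_fset (msupp g)) => [|F s IH].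
  under eq_fun => z do rewrite big_nil.
  under [X in primitive_co _ _ X]eq_fun => z do rewrite big_nil mulr0.
  exact: primitive0.
under eq_fun => z do rewrite big_cons.
under [X in primitive_co _ _ X]eq_fun => z do rewrite big_cons mulrDr.
apply: primitiveD => //.
have := primitiveZ g@_F (Aeps_primitive w F e01).
by under [X in primitive_co _ _ X]eq_fun => z do rewrite mulrCA.
Qed.

(** Integration is a Rota-Baxter operator of weight 0: both sides of the
    identity are primitives of the same function, by the product rule. *)
Lemma Aeps_shuffle op e F G z : 0 < e < 1 -> e <= z < 1 ->
  eval_at (@Aeps R e) z (fshuffle 0 op F G) = Aeps e F z * Aeps e G z.
Proof.
move=> e01; apply: (@fold_shuffle _ _ _ _ _ (fun x => e <= x < 1)) => {F G z}
  [a u v uv x /andP[ex x1]|a g x x1|a b F G x x1 U V].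
- apply: eq_Rintegral => y; rewrite inE /= in_itv /= => /andP[ey yx].
  by rewrite uv // ey (le_lt_trans yx).
- have p := primitive_fold a e01 (eval_at_Aeps_co g e01).
  exact: (primitive_uniq (eval_at_BplusL_primitive a g e01) p).
have pU : primitive_co e U _ := primitive_fold a e01 (Aeps_co F e01).
have pV : primitive_co e V _ := primitive_fold b e01 (Aeps_co G e01).
rewrite mul0r addr0.
have c1 := continuous_coM (Aeps_co F e01) (let: And3 c _ _ := pV in c).
have c2 := continuous_coM (let: And3 c _ _ := pU in c) (Aeps_co G e01).
have p := primitiveD (primitive_fold a e01 c1) (primitive_fold b e01 c2).
apply: (primitive_uniq (primitiveM pU pV) p) => // y _.
by rewrite -mulrA [U y * _]mulrCA.
Qed.

Lemma sigma_ge0 w t : 0 < t < 1 -> 0 <= sigma w t :> R.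
Proof.
by move=> /andP[t0 t1]; case: w; rewrite /= invr_ge0 ?subr_ge0 ltW.
Qed.

Lemma Aeps_ge0 e F z : 0 < e < 1 -> e <= z < 1 -> 0 <= Aeps e F z.
Proof.
move=> e01; elim/forest_ind: F z => [|F G IF IG|w F IF] z z1.
- by rewrite Aeps1.
- by rewrite AepsM mulr_ge0 ?IF ?IG.
have [c A0 dA] := Aeps_primitive w F e01.
have d0 x : e < x < 1 -> is_derive x (1 : R) (fun=> 0 : R) (0 : R).
  by move=> _; exact: is_derive_cst.
apply: (ler_derive (continuous_co_cst e 0) c d0 dA _ _ z1); last by rewrite A0.
move=> x /andP[ex x1]; rewrite mulr_ge0 ?IF ?(ltW ex) // sigma_ge0 // x1 andbT.
by apply: lt_trans ex; case/andP: e01.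
Qed.

End IteratedIntegrals.

(** * Bounds on iterated integrals *)

Section Convergence.
Variable R : realType.
Local Open Scope classical_set_scope.
Local Open Scope ring_scope.
Implicit Types (e z : R) (F G : forest letter).

Lemma Aeps_anti e a F z : 0 < e -> e <= a -> a < 1 -> a <= z < 1 ->
  Aeps a F z <= Aeps e F z.
Proof.
move=> e0 ea a1; have a0 := lt_le_trans e0 ea.
have e01 : 0 < e < 1 by rewrite e0 (le_lt_trans ea).
have a01 : 0 < a < 1 by rewrite a0.
elim/forest_ind: F z => [|F G IF IG|w F IF] z z1.
- by rewrite !Aeps1.
- by rewrite !AepsM ler_pM ?IF ?IG ?Aeps_ge0.
have [c A0 dA] := Aeps_primitive w F a01.
have [c' _ dA'] := Aeps_primitive w F e01.
have {}dA' x : a < x < 1 ->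
    is_derive x (1 : R) (Aeps e (ucm (Bplus w F))) (sigma w x * Aeps e F x).
  by move=> /andP[ax x1]; apply: dA'; rewrite (le_lt_trans ea).
apply: (ler_derive c (continuous_coW ea a1 c') dA dA' _ _ z1).
  move=> x /andP[ax x1]; apply: ler_wpM2l.
    by rewrite sigma_ge0 // (lt_trans a0).
  by apply: IF; rewrite ltW.
by rewrite A0 Aeps_ge0 ?ea.
Qed.

Lemma Aeps_homo e F y z : 0 < e < 1 -> e <= y -> y <= z -> z < 1 ->
  Aeps e F y <= Aeps e F z.
Proof.
move=> e01 ey; have /andP[e0 e1] := e01.
elim/forest_ind: F y z ey => [|F G IF IG|w F IF] y z ey yz z1.
- by rewrite !Aeps1.
- by rewrite !AepsM ler_pM ?IF ?IG ?Aeps_ge0 // ey (le_lt_trans yz).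
have [c A0 dA] := Aeps_primitive w F e01.
have y1 := le_lt_trans yz z1.
have d0 x : y < x < 1 ->
    is_derive x (1 : R) (fun=> Aeps e (ucm (Bplus w F)) y : R) (0 : R).
  by move=> _; exact: is_derive_cst.
have {}dA x : y < x < 1 ->
    is_derive x (1 : R) (Aeps e (ucm (Bplus w F))) (sigma w x * Aeps e F x).
  by move=> /andP[yx x1]; apply: dA; rewrite (le_lt_trans ey).
apply: (ler_derive (continuous_co_cst y _) (continuous_coW ey y1 c) d0 dA) => //.
  move=> x /andP[yx x1]; have ex := le_lt_trans ey yx.
  by rewrite mulr_ge0 ?Aeps_ge0 ?sigma_ge0 // ?(ltW ex) ?(lt_trans e0 ex).
by rewrite yz.
Qed.

(** Normalised to be at least 1 on [[0, 1[], so that its powers increase with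
    the exponent; its derivative is [sigma Y]. *)
Definition log1 z : R := 1 - ln (1 - z).

Lemma log1_ge1 z : 0 <= z < 1 -> 1 <= log1 z.
Proof.
move=> /andP[z0 z1]; rewrite /log1 lerBrDr gerDl ln_le0 //.
by rewrite gerBl.
Qed.

Lemma is_derive_log1 z : z < 1 -> is_derive z (1 : R) log1 (1 - z)^-1.
Proof.
move=> z1; have d1 : is_derive z (1 : R) (fun t : R => 1 - t) (0 - 1).
  exact: is_deriveB.
have z1' : 0 < 1 - z by rewrite subr_gt0.
have d2 :=
  @is_derive1_comp R (@ln R) (fun t => 1 - t) z _ _ (is_derive1_ln z1') d1.
have d3 : is_derive z (1 : R) log1 (0 - (1 - z)^-1 * (0 - 1)).
  exact: (is_deriveB (is_derive_cst _ _ _) d2).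
by apply: (is_derive_eq d3); rewrite !sub0r mulrN1 opprK.
Qed.

Lemma is_derive_log1X z k : z < 1 ->
  is_derive z (1 : R) (fun t => log1 t ^+ k.+1) (k.+1%:R * log1 z ^+ k / (1 - z)).
Proof.
by move=> z1; have := is_deriveX k.+1 (is_derive_log1 z1); rewrite exprfctE.
Qed.

(** The bound for a tree with [k.+1] vertices. *)
Definition log1_bound k z : R := z * log1 z ^+ k.+1.

Lemma is_derive_log1_bound k z : z < 1 -> is_derive z (1 : R) (log1_bound k)
  (z * (k.+1%:R * log1 z ^+ k / (1 - z)) + log1 z ^+ k.+1).
Proof.
move=> z1.
apply: (is_derive_eq
  (is_deriveM (is_derive_id z (1 : R)) (is_derive_log1X k z1))).
by rewrite /GRing.scale /= mulr1.
Qed.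

(** By the identity [1 / (1 - z) = z / (1 - z) + 1], the right-hand side
    dominates the integrand of a tree with root [Y]. *)
Lemma le_derive_bound k z : 0 <= z < 1 ->
  (1 - z)^-1 * log1 z ^+ k <=
    z * (k.+1%:R * log1 z ^+ k / (1 - z)) + log1 z ^+ k.+1.
Proof.
move=> z01; have g1 := log1_ge1 z01; have /andP[z0 z1] := z01.
have i0 : 0 <= (1 - z)^-1 by rewrite invr_ge0 subr_ge0 ltW.
have g0 : 0 <= log1 z ^+ k by rewrite exprn_ge0 // (le_trans ler01).
have -> : (1 - z)^-1 * log1 z ^+ k =
    z * (1 * log1 z ^+ k / (1 - z)) + 1 * log1 z ^+ k.
  by field; rewrite subr_eq0 gt_eqF.
apply: lerD; last by rewrite exprS; exact: ler_wpM2r.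
by rewrite ler_wpM2l // ler_wpM2r // ler_wpM2r // ler1n.
Qed.

(** The derivative of [log1_bound] dominates both integrands: for a root [Y] by
    [le_derive_bound], and for a root [X], which has a child, because the
    factor [z] of the bound on the child cancels the pole of [sigma X]. *)
Lemma Aeps_le e F : 0 < e < 1 -> leaves_Y F -> forall z, e <= z < 1 ->
  Aeps e F z <= (if F == mone then 1 else z) * log1 z ^+ fsize F.
Proof.
move=> e01; have /andP[e0 e1] := e01.
elim/forest_ind: F => [|F G IF IG|w F IF] + z /andP[ez z1].
- by rewrite eqxx Aeps1 mul1r /fsize trees1 big_nil expr0.
- rewrite /leaves_Y all_treesM => /andP[FY GY].
  have zr : e <= z < 1 by rewrite ez.
  have := ler_pM (Aeps_ge0 F e01 zr) (Aeps_ge0 G e01 zr) (IF FY _ zr) (IG GY _ zr).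
  rewrite -AepsM => /le_trans; apply.
  rewrite mulrACA fsizeM -exprD.
  have z0 := lt_le_trans e0 ez.
  have p0 : 0 <= log1 z ^+ (fsize F + fsize G).
    by rewrite exprn_ge0 // (le_trans ler01) // log1_ge1 // ltW.
  apply: ler_wpM2r => //.
  have [->|F0] := eqVneq F mone; first by rewrite mul1m mul1r.
  have -> : (mmul F G == mone) = false.
    apply: contraNF F0; rewrite -!trees_eq0 => /eqP e3.
    by have := perm_size (perm_treesM F G); rewrite e3 size_cat => /esym/eqP;
      rewrite addn_eq0 size_eq0 => /andP[].
  case: eqP => _; first by rewrite mulr1.
  by rewrite ler_piMr // ltW.
rewrite /leaves_Y all_treesU leaves_branchings_Y_Bplus => /andP[w1 FY].
rewrite cm1_eq1 fsizeU tsons_Bplus.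
have [c A0 dA] := Aeps_primitive w F e01.
have Bc : continuous_co e (log1_bound (fsize F)).
  by apply: (derive_continuous_co e1) => x; exact: is_derive_log1_bound.
have dB x : e < x < 1 -> is_derive x (1 : R) (log1_bound (fsize F))
    (x * ((fsize F).+1%:R * log1 x ^+ fsize F / (1 - x)) + log1 x ^+ (fsize F).+1).
  by move=> /andP[_ x1]; exact: is_derive_log1_bound.
apply: (ler_derive c Bc dA dB) => [x /andP[ex x1]||]; last by rewrite ez.
  have x0 := lt_trans e0 ex.
  have g0 : 0 <= log1 x ^+ fsize F.
    by rewrite exprn_ge0 // (le_trans ler01) // log1_ge1 // ltW.
  apply: le_trans (le_derive_bound (fsize F) (_ : 0 <= x < 1)); last by rewrite ltW.
  have i1 : 1 <= (1 - x)^-1 by rewrite invf_ge1 ?subr_gt0 // gerBl ltW.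
  have AF : Aeps e F x <= _ := IF FY x (introT andP (conj (ltW ex) x1)).
  case: w w1 {c A0 dA} => /= w1; last first.
    rewrite ler_wpM2l // ?(le_trans ler01) // (le_trans AF) //.
    by case: ifP => _; rewrite ?mul1r // ler_piMl // ltW.
  have F0 : F != mone.
    by rewrite -trees_eq0; apply: contraL w1 => /eqP ->.
  rewrite (negPf F0) in AF.
  rewrite ler_pdivrMl // (le_trans AF) // ler_wpM2l ?(ltW x0) //.
  by rewrite ler_peMl.
rewrite A0 mulr_ge0 ?(ltW e0) // exprn_ge0 // (le_trans ler01) // log1_ge1 //.
by rewrite ltW.
Qed.

End Convergence.

(** * Limits of iterated integrals *)

Section ZetaShuffle.
Variable R : realType.
Local Open Scope classical_set_scope.
Local Open Scope ring_scope.
Implicit Types (e z : R) (F G : forest letter).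

(** A primitive of [log1 z ^+ k], by integration by parts against [z - 1].  It
    is nonpositive on [[0, 1[], which expresses the integrability of the powers
    of [log1] up to 1. *)
Fixpoint log1_primitive k z : R :=
  if k is j.+1 then (z - 1) * log1 z ^+ k + k%:R * log1_primitive j z else z - 1.

Lemma is_derive_log1_primitive k z : z < 1 ->
  is_derive z (1 : R) (log1_primitive k) (log1 z ^+ k).
Proof.
move=> z1; have d1 : is_derive z (1 : R) (fun t : R => t - 1) 1.
  apply: (is_derive_eq
    (is_deriveB (is_derive_id z (1 : R)) (is_derive_cst (1 : R) z 1))).
  by rewrite subr0.
elim: k => [|k IH]; first exact: d1.
have d2 := is_deriveD (is_deriveM d1 (is_derive_log1X k z1))
  (is_deriveZ k.+1%:R IH).
apply: (is_derive_eq d2); rewrite /GRing.scale /= exprS.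
by field; rewrite subr_eq0 gt_eqF.
Qed.

Lemma log1_primitive_le0 k z : 0 <= z < 1 -> log1_primitive k z <= 0.
Proof.
move=> z01; have g1 := log1_ge1 z01; case/andP: z01 => z0 z1.
have z1' : z - 1 <= 0 by rewrite subr_le0 ltW.
elim: k => [|k IH] //=; rewrite -[0]addr0; apply: lerD; last by rewrite mulr_ge0_le0.
by rewrite mulr_le0_ge0 // exprn_ge0 // (le_trans ler01).
Qed.

Lemma conv_sh_leaves_Y F : conv_sh F -> leaves_Y F.
Proof. by apply: sub_all => T /andP[]. Qed.

(** Under a root [X], [Aeps_le] bounds the integrand by a power of [log1], whose
    primitive is bounded uniformly in [e] and [z]. *)
Lemma Aeps_bounded F : conv_sh F ->
  exists2 C, 0 <= C & forall e z, 0 < e < 1 -> e <= z < 1 -> Aeps e F z <= C.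
Proof.
move=> /allP cF; rewrite -(treesK F) /forest_of big_seq.
apply: (big_ind (fun G => exists2 C, 0 <= C &
  forall e z, 0 < e < 1 -> e <= z < 1 -> Aeps e G z <= C))
  => [|F1 F2 [C1 C10 b1] [C2 C20 b2]|T TF].
- by exists 1 => // e z _ _; rewrite Aeps1.
- exists (C1 * C2) => [|e z e1 z1]; first exact: mulr_ge0.
  by rewrite AepsM ler_pM ?Aeps_ge0 ?b1 ?b2.
have /andP[/eqP rT lT] := cF _ TF.
have eT : Bplus X (tsons T) = T by rewrite -rT BplusK.
move: lT; rewrite -eT leaves_branchings_Y_Bplus => /andP[s1 YG].
move: (tsons T) s1 YG => {eT rT TF T cF F} G s1 YG.
have G0 : G != mone.
  by rewrite -trees_eq0; apply: contraL s1 => /eqP ->.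
pose k := fsize G; exists (- log1_primitive k 0).
  by rewrite oppr_ge0 log1_primitive_le0 // lexx ltr01.
move=> e z e01 z1; have /andP[e0 e1] := e01; have /andP[ez zl1] := z1.
apply: (@le_trans _ _ (log1_primitive k z - log1_primitive k 0)); last first.
  by rewrite gerDr log1_primitive_le0 // zl1 andbT (le_trans (ltW e0)).
have Qd (x c : R) : x < 1 ->
    is_derive x (1 : R) (fun t => log1_primitive k t - c) (log1 x ^+ k).
  move=> x1; apply: (is_derive_eq
    (is_deriveB (is_derive_log1_primitive k x1) (is_derive_cst c x (1 : R)))).
  by rewrite subr0.
have Qc (a c : R) : a < 1 -> continuous_co a (fun t => log1_primitive k t - c).
  by move=> a1; apply: (derive_continuous_co a1) => x; exact: Qd.
have [c A0 dA] := Aeps_primitive X G e01.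
apply: (ler_derive c (Qc e _ e1) dA (fun x x1 => Qd x _ (proj2 (andP x1))) _ _ z1).
  move=> x /andP[ex x1]; have x0 := lt_trans e0 ex.
  rewrite /= ler_pdivrMl //; apply: le_trans (Aeps_le e01 YG (_ : e <= x < 1)) _.
    by rewrite ltW.
  by rewrite (negPf G0).
rewrite A0 subr_ge0.
(* The primitive increases from 0 to [e], so the bound does not depend on [e]. *)
have d0 (x : R) : 0 < x < 1 ->
    is_derive x (1 : R) (fun=> log1_primitive k 0 : R) (0 : R).
  by move=> _; exact: is_derive_cst.
have := ler_derive (continuous_co_cst 0 _) (Qc 0 0 ltr01) d0
  (fun x x1 => Qd x 0 (proj2 (andP x1))) _ _ (_ : 0 <= e < 1).
rewrite !subr0; apply; rewrite ?lexx ?(ltW e0) //.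
move=> x /andP[x0 x1].
by rewrite exprn_ge0 // (le_trans ler01) // log1_ge1 // ltW.
Qed.

Definition Azero F z : R := lim ((fun e : R => Aeps e F z) @ (0 : R)^'+).

Lemma Azero_cvg F z : leaves_Y F -> 0 < z < 1 ->
  Aeps e F z @[e --> 0^'+] --> Azero F z.
Proof.
move=> FY /andP[z0 z1].
apply: (@nonincreasing_at_right_is_cvgr R (fun e => Aeps e F z) 0).
- apply: filterS (nbhs_right_lt z0) => x /ltW xz e a; rewrite !in_itv /=.
  move=> /andP[e0 ex] /andP[a0 ax] ea.
  apply: Aeps_anti => //; first by apply: lt_trans z1; exact: lt_le_trans xz.
  by rewrite z1 andbT ltW // (lt_le_trans ax).
- apply: filterS (nbhs_right_lt z0) => x xz.
  exists ((if F == mone then 1 else z) * log1 z ^+ fsize F).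
  move=> w [e /=]; rewrite in_itv /= => /andP[e0 ex] <-.
  have ez := lt_trans ex xz.
  have e01 : 0 < e < 1 by rewrite e0 (lt_trans ez).
  by apply: (Aeps_le e01 FY); rewrite ltW.
Qed.

Lemma Azero_cvg1 F : conv_sh F ->
  Azero F z @[z --> 1^'-] --> lim (Azero F z @[z --> 1^'-]).
Proof.
move=> cF; have FY := conv_sh_leaves_Y cF.
apply: (@nondecreasing_at_left_is_cvgr R (Azero F) 1).
- apply: filterS (nbhs_left_gt ltr01) => x x0 y z; rewrite !in_itv /=.
  move=> /andP[xy y1] /andP[xz z1] yz.
  have y0 := lt_trans x0 xy; have z0 := lt_le_trans y0 yz.
  apply: (ler_cvg_to (Azero_cvg FY _) (Azero_cvg FY _)); rewrite ?y0 ?z0 //.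
  near=> e; have ey : e < y by near: e; exact: nbhs_right_lt.
  apply: Aeps_homo => //; last exact: ltW.
  by rewrite (lt_trans ey y1) andbT; near: e; exact: nbhs_right_gt.
- apply: filterS (nbhs_left_gt ltr01) => x x0.
  have [C C0 bC] := Aeps_bounded cF; exists C.
  move=> w [z /=]; rewrite in_itv /= => /andP[xz z1] <-.
  have z0 := lt_trans x0 xz.
  apply: limr_le; first by apply: (cvgP _ (Azero_cvg FY _)); rewrite z0.
  near=> e; have ez : e < z by near: e; exact: nbhs_right_lt.
  apply: bC; last by rewrite ltW.
  by rewrite (lt_trans ez z1) andbT; near: e; exact: nbhs_right_gt.
Unshelve. all: by end_near. Qed.

Lemma Azero_shuffle op F G z : leaves_Y F -> leaves_Y G -> 0 < z < 1 ->
  eval_at Azero z (fshuffle 0 op F G) = Azero F z * Azero G z.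
Proof.
move=> FY GY z01; have /andP[z0 z1] := z01.
apply: (@limit_shuffle _ _ _ _ R (0 : R)^'+ _ leaves_Y (fun H e => Aeps e H z)
  (fun H => Azero H z)) => //.
- by move=> H HY; exact: Azero_cvg.
- exact: shuffle_leaves_Y.
near=> e; have ez : e < z by near: e; exact: nbhs_right_lt.
have e01 : 0 < e < 1.
  by rewrite (lt_trans ez z1) andbT; near: e; exact: nbhs_right_gt.
have ez1 : e <= z < 1 by rewrite ltW.
by have := Aeps_shuffle op F G e01 ez1; rewrite /eval_at.
Unshelve. all: by end_near. Qed.

Lemma Azero1 z : Azero mone z = 1.
Proof.
rewrite /Azero (_ : (fun e => _) = cst 1); last by apply/funext => e; rewrite Aeps1.
by apply: lim_cst; exact: Rhausdorff.
Qed.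

Lemma zeta_sh_morphism op :
  is_algebra_morphism (forest_span R conv_sh) (shuffle 0 op) (zeta_sh R).
Proof.
apply: algebra_morphism_linext => [||F G|F G cF cG].
- by rewrite /conv_sh trees1.
- rewrite (_ : (fun z => _) = cst 1); last by apply/funext => z; exact: Azero1.
  by apply: lim_cst; exact: Rhausdorff.
- exact: shuffle_conv_sh.
apply: (@limit_shuffle _ _ _ _ R (1 : R)^'- _ conv_sh Azero) => //.
- by move=> H; exact: Azero_cvg1.
- exact: shuffle_conv_sh.
near=> z; apply: Azero_shuffle; try exact: conv_sh_leaves_Y.
apply/andP; split; near: z; first exact: nbhs_left_gt.
exact: nbhs_left_lt.
Unshelve. all: by end_near. Qed.

End ZetaShuffle.

Theorem theorem4 (R : realType) :
  [/\ is_algebra_morphism (forest_span R conv_st) (shuffle 1 addNpos) (zeta_st R),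
      is_algebra_morphism (forest_span R conv_st) (shuffle (- 1) addNpos)
        (zeta_st_star R)
    & forall op : letter -> letter -> letter,
      is_algebra_morphism (forest_span R conv_sh) (shuffle 0 op) (zeta_sh R)].
Proof.
split; first exact: (zeta_series_morphism R false).
  exact: (zeta_series_morphism R true).
exact: zeta_sh_morphism.
Qed.
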